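(* Let $0<\beta<\alpha\le\pi$, let $f:\mathbb{R}\to\mathbb{R}$ be locally Lipschitz, and let $u$ be a solution of the mixed boundary value problem in the sub-spherical sector $\Sigma$ stated in the context. Let $\Lambda\in(0,l_N)$. Suppose there exists an angle $\vartheta_C\in(0,\pi)$ with $\vartheta_C\ge\vartheta_B(\Lambda)$ and $\vartheta_C>\pi/2$ such that, for $\lambda=\Lambda$ and every $\vartheta\in(0,\vartheta^A(\lambda)]\cup[\vartheta_B(\lambda),\vartheta_C]$, $$u_{x_1}\sin(\vartheta-\tfrac\beta2)-u_{x_2}\cos(\vartheta-\tfrac\beta2)<0\ \text{ on }T_{\lambda,\vartheta}\cap\Sigma,\qquad u_{x_1}\sin(\vartheta-\tfrac\beta2)+u_{x_2}\cos(\vartheta-\tfrac\beta2)<0\ \text{ on }\hat T_{\lambda,\vartheta}\cap\Sigma.$$ Then, for $\lambda=\Lambda$, $$u_{x_1}\cos\tfrac\beta2-u_{x_2}\sin\tfrac\beta2<0\ \text{ on }T_{\lambda,\pi/2}\cap\Gamma_N^-,\qquad u_{x_1}\cos\tfrac\beta2+u_{x_2}\sin\tfrac\beta2<0\ \text{ on }\hat T_{\lambda,\pi/2}\cap\Gamma_N^+.$$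
   Context: Geometry (vertex at the origin). For $0<\beta<\alpha\le\pi$ put $a=-\sin\frac{\alpha-\beta}{2}/\sin\frac\beta2<0$, $V=(0,0)$, $O=(-a,0)$, $P_\pm=(\cos\frac\alpha2-a,\pm\sin\frac\alpha2)$, $\Sigma=\{(x_1,x_2): |x_2|\cot\frac\beta2<x_1<\sqrt{1-x_2^2}-a\}$, $\Gamma_D=\{(\cos\theta-a,\sin\theta):|\theta|\le\alpha/2\}$, $\Gamma_N=\partial\Sigma\setminus\Gamma_D$, $\Gamma_N^-=\{x\in\Gamma_N:x_2<0\}$, $\Gamma_N^+=\{x\in\Gamma_N:x_2>0\}$ (open segments). $l_N=\sin\frac\alpha2/\sin\frac\beta2$ is the length of $\Gamma_N^-$. Problem: $\Delta u+f(u)=0$ and $u>0$ in $\Sigma$, $\partial u/\partial\nu=0$ on $\Gamma_N$ ($\nu$ outward unit normal, away from $V$), $u=0$ on $\Gamma_D$. Solutions are classical, $u\in C^2(\Sigma)\cap C(\overline\Sigma)\cap C^1(\Sigma\cup\Gamma_N)$, and by standard regularity $u\in C(\overline\Sigma)\cap C^2(\overline\Sigma\setminus\{V,P_\pm\})$ throughout. Lines. For $\lambda>0$ let $x_{1\lambda}=\lambda\cos\frac\beta2$, $x_{2\lambda}=-\lambda\sin\frac\beta2$, $P_\lambda=(x_{1\lambda},x_{2\lambda})$, $T_{\lambda,\vartheta}=\{x:(x_1-x_{1\lambda})\sin(\vartheta-\frac\beta2)-(x_2-x_{2\lambda})\cos(\vartheta-\frac\beta2)=0\}$ and $\hat T_{\lambda,\vartheta}=\{x:(x_1-x_{1\lambda})\sin(\vartheta-\frac\beta2)+(x_2+x_{2\lambda})\cos(\vartheta-\frac\beta2)=0\}$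 (the mirror image of $T_{\lambda,\vartheta}$ in $\{x_2=0\}$). Angles (with $\operatorname{arccot}$ taking values in $(0,\pi)$): $\vartheta_A(\lambda)=\operatorname{arccot}\frac{|a|\cos(\beta/2)-\lambda}{|a|\sin(\beta/2)}$ (for which $T_{\lambda,\vartheta}\ni O$), $\vartheta_B(\lambda)=\operatorname{arccot}\frac{l_N\cos\beta-\lambda}{l_N\sin\beta}$ (for which $T_{\lambda,\vartheta}\ni P_+$), $\vartheta^A(\lambda)=\min\{\vartheta_A(\lambda),\vartheta_B(\lambda),\frac{\pi+\beta}2\}$. *)

(* Defs.v *)
From Stdlib Require Import Reals.
From Coquelicot Require Import Coquelicot.
Open Scope R_scope.

Definition cot (t : R) : R := cos t / sin t.

(* The branch with values in (0, PI). *)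
Definition arccot (y : R) : R := PI / 2 - atan y.

Definition locally_lipschitz (f : R -> R) : Prop :=
  forall s, exists d L, 0 < d /\
    forall y z, Rabs (y - s) < d -> Rabs (z - s) < d ->
      Rabs (f y - f z) <= L * Rabs (y - z).

Definition closure (A : R * R -> Prop) (x : R * R) : Prop :=
  forall eps : posreal, exists y, ball x eps y /\ A y.

Definition boundary (A : R * R -> Prop) (x : R * R) : Prop :=
  closure A x /\ closure (fun y => ~ A y) x.

(* Partial derivatives; [Derive] is meaningful only together with [ex_D1],
   [ex_D2], and these are only used at points of an open set. *)
Definition D1 (g : R * R -> R) (x : R * R) : R :=
  Derive (fun t => g (t, snd x)) (fst x).
Definition D2 (g : R * R -> R) (x : R * R) : R :=
  Derive (fun t => g (fst x, t)) (snd x).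
Definition ex_D1 (g : R * R -> R) (x : R * R) : Prop :=
  ex_derive (fun t => g (t, snd x)) (fst x).
Definition ex_D2 (g : R * R -> R) (x : R * R) : Prop :=
  ex_derive (fun t => g (fst x, t)) (snd x).

Definition laplacian (g : R * R -> R) (x : R * R) : R :=
  D1 (D1 g) x + D2 (D2 g) x.

Definition extends_continuously (Om E : R * R -> Prop) (g : R * R -> R) : Prop :=
  exists h : R * R -> R, (forall x, Om x -> h x = g x) /\ continuous_on E h.

(* g is C^n(E), for Om open and Om included in E included in closure Om: all
   partial derivatives of order <= n exist in Om and extend continuously to E.
   For E = Om this is the usual C^n(Om). *)
Fixpoint Cn (n : nat) (Om E : R * R -> Prop) (g : R * R -> R) : Prop :=
  extends_continuously Om E g /\
  match n with
  | O => True
  | S m => (forall x, Om x -> ex_D1 g x /\ ex_D2 g x) /\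
           Cn m Om E (D1 g) /\ Cn m Om E (D2 g)
  end.

(* Limit of g at x from within Om, i.e. the value at x of the continuous
   extension of g. *)
Definition trace (Om : R * R -> Prop) (g : R * R -> R) (x : R * R) : R :=
  iota (fun l : R => filterlim g (within Om (locally x)) (locally l)).

Definition sec_a (alpha beta : R) : R :=
  - sin ((alpha - beta) / 2) / sin (beta / 2).

Definition ptV : R * R := (0, 0).

Definition ptP_plus (alpha beta : R) : R * R :=
  (cos (alpha / 2) - sec_a alpha beta, sin (alpha / 2)).
Definition ptP_minus (alpha beta : R) : R * R :=
  (cos (alpha / 2) - sec_a alpha beta, - sin (alpha / 2)).

(* [Rabs (snd x) <= 1] makes explicit that the square root must be defined,
   since [sqrt] is 0 on negative numbers. *)
Definition Sigma (alpha beta : R) (x : R * R) : Prop :=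
  Rabs (snd x) <= 1 /\
  Rabs (snd x) * cot (beta / 2) < fst x /\
  fst x < sqrt (1 - snd x ^ 2) - sec_a alpha beta.

Definition Gamma_D (alpha beta : R) (x : R * R) : Prop :=
  exists theta, Rabs theta <= alpha / 2 /\
    x = (cos theta - sec_a alpha beta, sin theta).

(* Contains the vertex V. *)
Definition Gamma_N (alpha beta : R) (x : R * R) : Prop :=
  boundary (Sigma alpha beta) x /\ ~ Gamma_D alpha beta x.
Definition Gamma_N_minus (alpha beta : R) (x : R * R) : Prop :=
  Gamma_N alpha beta x /\ snd x < 0.
Definition Gamma_N_plus (alpha beta : R) (x : R * R) : Prop :=
  Gamma_N alpha beta x /\ 0 < snd x.

Definition l_N (alpha beta : R) : R := sin (alpha / 2) / sin (beta / 2).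

(* Components of the outward unit normal on Gamma_N away from V: the two sides
   are the rays in the directions (cos (beta/2), +- sin (beta/2)). *)
Definition nu1 (beta : R) (x : R * R) : R := - sin (beta / 2).
Definition nu2 (beta : R) (x : R * R) : R := sign (snd x) * cos (beta / 2).

Definition Sigma_Gamma_N (alpha beta : R) (x : R * R) : Prop :=
  Sigma alpha beta x \/ Gamma_N alpha beta x.

Definition closure_minus_corners (alpha beta : R) (x : R * R) : Prop :=
  closure (Sigma alpha beta) x /\
  x <> ptV /\ x <> ptP_plus alpha beta /\ x <> ptP_minus alpha beta.

Record classical_solution (alpha beta : R) (f : R -> R) (u : R * R -> R) : Prop := {
  sol_C2 : Cn 2 (Sigma alpha beta) (Sigma alpha beta) u;
  sol_C0 : continuous_on (closure (Sigma alpha beta)) u;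
  sol_C1 : Cn 1 (Sigma alpha beta) (Sigma_Gamma_N alpha beta) u;
  sol_eq : forall x, Sigma alpha beta x -> laplacian u x + f (u x) = 0;
  sol_pos : forall x, Sigma alpha beta x -> 0 < u x;
  sol_neumann : forall x, Gamma_N alpha beta x -> x <> ptV ->
    trace (Sigma alpha beta) (D1 u) x * nu1 beta x +
    trace (Sigma alpha beta) (D2 u) x * nu2 beta x = 0;
  sol_dirichlet : forall x, Gamma_D alpha beta x -> u x = 0
}.

(* Standard regularity, assumed of all solutions (continuity on the closure is
   already part of [classical_solution]). *)
Definition regular_up_to_corners (alpha beta : R) (u : R * R -> R) : Prop :=
  Cn 2 (Sigma alpha beta) (closure_minus_corners alpha beta) u.

Definition x1_of (beta lambda : R) : R := lambda * cos (beta / 2).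
Definition x2_of (beta lambda : R) : R := - lambda * sin (beta / 2).

Definition lineT (beta lambda vt : R) (x : R * R) : Prop :=
  (fst x - x1_of beta lambda) * sin (vt - beta / 2) -
  (snd x - x2_of beta lambda) * cos (vt - beta / 2) = 0.
Definition lineT_hat (beta lambda vt : R) (x : R * R) : Prop :=
  (fst x - x1_of beta lambda) * sin (vt - beta / 2) +
  (snd x + x2_of beta lambda) * cos (vt - beta / 2) = 0.

Definition theta_A (alpha beta lambda : R) : R :=
  arccot ((Rabs (sec_a alpha beta) * cos (beta / 2) - lambda) /
          (Rabs (sec_a alpha beta) * sin (beta / 2))).
Definition theta_B (alpha beta lambda : R) : R :=
  arccot ((l_N alpha beta * cos beta - lambda) / (l_N alpha beta * sin beta)).
Definition theta_sup_A (alpha beta lambda : R) : R :=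
  Rmin (theta_A alpha beta lambda)
       (Rmin (theta_B alpha beta lambda) ((PI + beta) / 2)).

(* Main.v *)
Require Import Defs.
From Stdlib Require Import Reals Lra Classical ClassicalEpsilon.
From Coquelicot Require Import Coquelicot.
Open Scope R_scope.

(** Write [P] for the point of the side [Gamma_N] at distance [lambda] from the
    vertex, and measure angles [th] at [P] into the sector, from the direction
    along the side that points away from the vertex.  By the Neumann condition
    the gradient of [u] at [P] is [c] times that direction, and the claim is
    [c < 0].  The hypothesis says that the angular derivative [W] of [u] about
    [P] is positive on the rays of angle [th <= theta_sup_A] and on those of
    angle [th] between [theta_B] and [theta_C].

    Suppose [c >= 0].  The second derivatives of [u] are bounded near [P], so
    [W = - c r sin th + O(r^2)] ([trace_rate]), hence [W <= M r^2].  This is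
    refuted by a maximum principle in cones with apex [P].  A function which
    satisfies a linear equation [Delta W + k W = 0] with [k] bounded, and which
    is positive in a cone of opening greater than [PI / m], stays above a
    positive multiple of [r^m] along the axis of the cone
    ([cone_lower_bound]).  So there would be a contradiction at once if [W] were
    positive in a cone of opening greater than [PI / 2], as then some [m < 2]
    is available ([no_positive_wide_cone]).

    The difficulty is the gap between [theta_sup_A] and [theta_B], where the
    sign of [W] is unknown.  It is closed by a comparison of decay rates.  In
    the gap the negative part of [W] decays at least like [r] to a power just
    below [PI] over the width of the gap, whereas the lower bound that comes
    from the cone below [theta_sup_A] decays like [r] to a power just above
    [PI / theta_sup_A].  If the gap is narrower than [theta_sup_A], that is
    if [theta_B < 2 theta_sup_A], the lower bound dominates near [P], and [W]
    is positive across the gap ([positive_across_gap]).  As [theta_C] exceeds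
    [PI / 2], this gives a cone of opening greater than [PI / 2].

    The inequality [theta_B < 2 theta_sup_A] is clear when [theta_sup_A] is
    [theta_B] or [(PI + beta) / 2], because [theta_B < PI].  That
    [theta_B < 2 theta_A] is elementary geometry ([theta_B_lt_2_theta_A]).
    Suppose [2 theta_A < PI].  The centre [O] of the arc is equidistant from
    the lines carrying the two sides, and the ray from [P] of angle
    [2 theta_A] is tangent to the circle about [O] touching both lines.
    Together with these lines it bounds a triangle, of which that circle is an
    escribed circle.  The side of this triangle on the line through [P_+] is
    shorter than half its perimeter, which is the length
    [|a| cos (beta / 2)] of the tangents from the vertex and is less than
    [l_N].  So the ray meets that line before [P_+], and the ray to [P_+]
    has a smaller angle.

    Since [f] is only Lipschitz, [W] itself need not be twice differentiable.
    The maximum principle is therefore applied to the difference of [u] and a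
    slightly rotated copy of [u], which does satisfy a linear equation with a
    bounded coefficient, and its conclusion is passed to [W].  All of this
    is done in the coordinates [t = ln r] and [th]: there rotations
    are translations, and the equation is
    [u_tt + u_thth + exp (2 t) f(u) = 0]. *)

(** * Second derivatives and the Laplacian in two real variables *)

(** The first derivative is required on a neighbourhood, so that [l] is a
    genuine second derivative; the total operator [Derive] would not say so. *)
Definition is_derive2 (f : R -> R) (x l : R) : Prop :=
  exists f' : R -> R,
    locally x (fun y => is_derive f y (f' y)) /\ is_derive f' x l.

Lemma is_derive2_plus (f g : R -> R) (x k l : R) :
  is_derive2 f x k -> is_derive2 g x l ->
  is_derive2 (fun y => f y + g y) x (k + l).
Proof.
  intros [f' [Hf Hf']] [g' [Hg Hg']].
  exists (fun y => f' y + g' y); split.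
  - generalize (filter_and _ _ Hf Hg); apply filter_imp.
    intros y [H1 H2]; exact (is_derive_plus f g y _ _ H1 H2).
  - exact (is_derive_plus f' g' x _ _ Hf' Hg').
Qed.

Lemma is_derive2_scal (f : R -> R) (x a l : R) :
  is_derive2 f x l -> is_derive2 (fun y => a * f y) x (a * l).
Proof.
  intros [f' [Hf Hf']].
  exists (fun y => a * f' y); split.
  - revert Hf; apply filter_imp.
    intros y H1; exact (is_derive_scal f y a _ H1).
  - exact (is_derive_scal f' x a _ Hf').
Qed.

Lemma is_derive2_min (f : R -> R) (x l : R) :
  is_derive2 f x l -> locally x (fun y => f x <= f y) -> 0 <= l.
Proof.
  intros [f' [Hf Hf']] Hmin.
  destruct (Rle_or_lt 0 l) as [Hl | Hl]; [exact Hl | exfalso].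
  destruct (filter_and _ _ Hf Hmin) as [d Hd].
  assert (Hd' : forall y, Rabs (y - x) < d -> is_derive f y (f' y) /\ f x <= f y).
  { intros y Hy; exact (Hd y Hy). }
  clear Hd Hf Hmin.
  assert (Hdpos := cond_pos d).
  assert (H0 : f' x = 0).
  { assert (Hx : is_derive f x (f' x)).
    { apply Hd'; rewrite Rminus_diag, Rabs_R0; exact Hdpos. }
    apply is_derive_Reals in Hx.
    pose (pr := exist _ (f' x) Hx : derivable_pt f x).
    change (f' x) with (derive_pt f x pr).
    apply (deriv_minimum f (x - d / 2) (x + d / 2)); try lra.
    intros y Hy1 Hy2; apply Hd'; apply Rabs_def1; lra. }
  apply is_derive_Reals in Hf'.
  destruct (Hf' (- l / 2)) as [e He]; [lra |].
  assert (Hepos := cond_pos e).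
  set (h := Rmin d e / 2).
  assert (Hh : 0 < h /\ h < d /\ h < e).
  { assert (H1 := Rmin_l d e); assert (H2 := Rmin_r d e).
    assert (H3 := Rmin_pos d e Hdpos Hepos); unfold h; lra. }
  destruct (MVT_cor2 f f' x (x + h)) as [c [Hfc Hc]]; [lra | |].
  { intros y Hy; apply is_derive_Reals, Hd', Rabs_def1; lra. }
  assert (Hge : f x <= f (x + h)) by (apply Hd', Rabs_def1; lra).
  specialize (He (c - x) ltac:(lra) ltac:(apply Rabs_def1; lra)).
  replace (x + (c - x)) with c in He by ring.
  apply Rabs_def2 in He; destruct He as [He _].
  rewrite H0, Rminus_0_r in He.
  assert (f' c < 0).
  { apply Rmult_lt_reg_r with (/ (c - x)).
    - apply Rinv_0_lt_compat; lra.
    - unfold Rdiv in He; lra. }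
  nra.
Qed.

Definition is_lap (F : R -> R -> R) (t th l : R) : Prop :=
  exists l1 l2,
    is_derive2 (fun s => F s th) t l1 /\ is_derive2 (F t) th l2 /\ l1 + l2 = l.

Lemma is_lap_plus (F G : R -> R -> R) (t th k l : R) :
  is_lap F t th k -> is_lap G t th l ->
  is_lap (fun s ph => F s ph + G s ph) t th (k + l).
Proof.
  intros [k1 [k2 [H1 [H2 <-]]]] [l1 [l2 [H3 [H4 <-]]]].
  exists (k1 + l1), (k2 + l2); repeat split.
  - exact (is_derive2_plus _ _ _ _ _ H1 H3).
  - exact (is_derive2_plus _ _ _ _ _ H2 H4).
  - ring.
Qed.

Lemma is_lap_scal (F : R -> R -> R) (t th a l : R) :
  is_lap F t th l -> is_lap (fun s ph => a * F s ph) t th (a * l).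
Proof.
  intros [l1 [l2 [H1 [H2 <-]]]].
  exists (a * l1), (a * l2); repeat split.
  - exact (is_derive2_scal _ _ a _ H1).
  - exact (is_derive2_scal _ _ a _ H2).
  - ring.
Qed.

Lemma is_lap_min (F : R -> R -> R) (t1 t2 p q t th l : R) :
  t1 < t < t2 -> p < th < q ->
  (forall s ph, t1 <= s <= t2 -> p <= ph <= q -> F t th <= F s ph) ->
  is_lap F t th l -> 0 <= l.
Proof.
  intros Ht Hth Hmin [l1 [l2 [H1 [H2 <-]]]].
  apply Rplus_le_le_0_compat.
  - apply is_derive2_min with (1 := H1).
    apply filter_imp with (fun s => t1 < s /\ s < t2).
    + intros s Hs; apply Hmin; lra.
    + apply filter_and; [apply open_gt | apply open_lt]; lra.
  - apply is_derive2_min with (1 := H2).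
    apply filter_imp with (fun s => p < s /\ s < q).
    + intros s Hs; apply Hmin; lra.
    + apply filter_and; [apply open_gt | apply open_lt]; lra.
Qed.

(** * The maximum principle on a rectangle *)

(** Minimise in the second variable first.  By uniform continuity the partial
    minimum is continuous in the first variable; composed with [clamp] it is
    continuous on the whole line. *)
Lemma rectangle_min (F : R -> R -> R) (t1 t2 p q : R) :
  t1 <= t2 -> p <= q ->
  (forall t th, t1 <= t <= t2 -> p <= th <= q -> continuity_2d_pt F t th) ->
  exists t th, t1 <= t <= t2 /\ p <= th <= q /\
    forall s ph, t1 <= s <= t2 -> p <= ph <= q -> F t th <= F s ph.
Proof.
  intros Ht Hp Hc.
  assert (Hrow : forall t, exists th, t1 <= t <= t2 ->
    p <= th <= q /\ forall ph, p <= ph <= q -> F t th <= F t ph).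
  { intros t.
    destruct (classic (t1 <= t <= t2)) as [H | H]; [| exists 0; tauto].
    destruct (continuity_ab_min (F t) p q Hp) as [th [H1 H2]].
    - intros ph Hph; apply continuity_pt_locally; intros eps.
      exact (locally_2d_1d_const_x _ _ _ (Hc t ph H Hph eps)).
    - exists th; tauto. }
  destruct (choice _ Hrow) as [m Hm]; clear Hrow.
  pose (clamp := fun t => Rmax t1 (Rmin t t2)).
  assert (Hcl : forall t, t1 <= clamp t <= t2).
  { intros t; unfold clamp; split; [apply Rmax_l |].
    apply Rmax_lub; [lra | apply Rmin_r]. }
  assert (Hid : forall t, t1 <= t <= t2 -> clamp t = t).
  { intros t H; unfold clamp; rewrite Rmin_left, Rmax_right; lra. }
  assert (Hlip : forall t t', Rabs (clamp t - clamp t') <= Rabs (t - t')).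
  { intros t t'; unfold clamp, Rmax, Rmin.
    repeat destruct Rle_dec; unfold Rabs; repeat destruct Rcase_abs; lra. }
  destruct (continuity_ab_min (fun t => F (clamp t) (m (clamp t))) t1 t2 Ht)
    as [t [H1 H2]].
  - intros t _; apply continuity_pt_locally; intros eps.
    destruct (uniform_continuity_2d F t1 t2 p q Hc eps) as [d Hd].
    exists d; intros t' Ht'.
    assert (Hb : Rabs (clamp t' - clamp t) < d).
    { eapply Rle_lt_trans; [apply Hlip | exact Ht']. }
    destruct (Hm _ (Hcl t)) as [Hm1 Hm2].
    destruct (Hm _ (Hcl t')) as [Hm1' Hm2'].
    assert (Hd0 : forall x, Rabs (x - x) < d).
    { intros x; rewrite Rminus_diag, Rabs_R0; apply cond_pos. }
    assert (E1 := Hd _ _ _ _ (Hcl t) Hm1 (Hcl t') Hm1 Hb (Hd0 _)).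
    assert (E2 := Hd _ _ _ _ (Hcl t) Hm1' (Hcl t') Hm1' Hb (Hd0 _)).
    apply Rabs_def2 in E1; apply Rabs_def2 in E2.
    specialize (Hm2 _ Hm1'); specialize (Hm2' _ Hm1).
    apply Rabs_def1; lra.
  - rewrite Hid in H1 by exact H2.
    destruct (Hm t H2) as [Hm1 Hm2].
    exists t, (m t); repeat split; try tauto.
    intros s ph Hs Hph.
    specialize (H1 s Hs); rewrite Hid in H1 by exact Hs.
    destruct (Hm s Hs) as [_ Hms].
    eapply Rle_trans; [exact H1 | exact (Hms ph Hph)].
Qed.

(** Minimum principle for [Z] relative to the positive supersolution [s], which
    takes the place of a sign condition on the zeroth order coefficient.  If
    [- m] is the minimum of [(Z - b) / s], then [Z - b + m s] has an interior
    minimum with value zero when [m > 1].  There its Laplacian is nonnegative, while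
    [|Z| <= b + m s] and the three differential inequalities make it
    negative. *)
Lemma comparison_on_rectangle (K Z b s lz lb ls : R -> R -> R) (t1 t2 p q : R) :
  t1 <= t2 -> p <= q ->
  (forall t th, t1 <= t <= t2 -> p <= th <= q ->
     continuity_2d_pt Z t th /\ continuity_2d_pt b t th /\
     continuity_2d_pt s t th /\ 0 <= b t th /\ 0 < s t th) ->
  (forall t th, t1 < t < t2 -> p < th < q ->
     is_lap Z t th (lz t th) /\ is_lap b t th (lb t th) /\
     is_lap s t th (ls t th) /\
     Rabs (lz t th) <= K t th * Rabs (Z t th) /\
     K t th * b t th <= lb t th /\ ls t th < - K t th * s t th /\
     0 <= K t th) ->
  (forall t th, t1 <= t <= t2 -> p <= th <= q ->
     t = t1 \/ t = t2 \/ th = p \/ th = q -> b t th - s t th <= Z t th) ->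
  forall t th, t1 <= t <= t2 -> p <= th <= q -> b t th - s t th <= Z t th.
Proof.
  intros Ht Hp Hcl Hin Hbd.
  destruct (rectangle_min (fun t th => (Z t th - b t th) * / s t th)
              t1 t2 p q Ht Hp) as [t0 [h0 [Ht0 [Hh0 Hmin]]]].
  { intros t th H1 H2; destruct (Hcl t th H1 H2) as [HZ [Hb [Hs [_ Hs0]]]].
    apply continuity_2d_pt_mult.
    - now apply continuity_2d_pt_minus.
    - apply continuity_2d_pt_inv; [exact Hs | lra]. }
  simpl in Hmin.
  set (m := - ((Z t0 h0 - b t0 h0) * / s t0 h0)).
  destruct (Hcl t0 h0 Ht0 Hh0) as [_ [_ [_ [Hb0 Hs0]]]].
  assert (HZ0 : Z t0 h0 = b t0 h0 - m * s t0 h0).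
  { unfold m; field; lra. }
  assert (Hge : forall t th, t1 <= t <= t2 -> p <= th <= q ->
            0 <= Z t th - b t th + m * s t th).
  { intros t th H1 H2; specialize (Hmin t th H1 H2).
    destruct (Hcl t th H1 H2) as [_ [_ [_ [_ Hs]]]].
    replace (Z t th - b t th + m * s t th)
      with (((Z t th - b t th) * / s t th + m) * s t th) by (field; lra).
    apply Rmult_le_pos; unfold m; lra. }
  destruct (Rle_or_lt m 1) as [Hm | Hm].
  { intros t th H1 H2; specialize (Hge t th H1 H2).
    destruct (Hcl t th H1 H2) as [_ [_ [_ [_ Hs]]]]; nra. }
  exfalso.
  assert (Hnb : ~ (t0 = t1 \/ t0 = t2 \/ h0 = p \/ h0 = q)).
  { intros H; specialize (Hbd t0 h0 Ht0 Hh0 H); nra. }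
  destruct (Hin t0 h0) as [Lz [Lb [Ls [Hz [Hb [Hs HK]]]]]]; [lra | lra |].
  assert (Hl : 0 <= lz t0 h0 + (-1 * lb t0 h0 + m * ls t0 h0)).
  { apply is_lap_min with
      (F := fun t th => Z t th + (-1 * b t th + m * s t th))
      (t1 := t1) (t2 := t2) (p := p) (q := q) (t := t0) (th := h0); [lra | lra | |].
    - intros t th H1 H2; specialize (Hge t th H1 H2); rewrite HZ0; lra.
    - apply is_lap_plus; [exact Lz |].
      apply is_lap_plus; now apply is_lap_scal. }
  assert (Ha : Rabs (Z t0 h0) <= b t0 h0 + m * s t0 h0).
  { rewrite HZ0; apply Rabs_le; nra. }
  assert (Hz' := Rle_abs (lz t0 h0)).
  nra.
Qed.

(** * The angular derivative of a solution in logarithmic polar coordinates *)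

Lemma is_lap_rotate (F : R -> R -> R) (t th e l : R) :
  is_lap F t (th + e) l -> is_lap (fun s ph => F s (ph + e)) t th l.
Proof.
  intros [l1 [l2 [H1 [[g [Hg Hg']] <-]]]].
  exists l1, l2; repeat split; [exact H1 |].
  assert (Hsh : forall y, is_derive (fun z => z + e) y 1).
  { intros y; auto_derive; [exact I | ring]. }
  exists (fun y => g (y + e)); split.
  - destruct Hg as [d Hd]; exists d; intros y Hy.
    replace (g (y + e)) with (scal 1 (g (y + e))) by exact (Rmult_1_l _).
    apply (is_derive_comp (F t) (fun z => z + e)); [| apply Hsh].
    apply Hd; change (Rabs (y + e - (th + e)) < d).
    replace (y + e - (th + e)) with (y - th) by ring; exact Hy.
  - replace l2 with (scal 1 l2) by exact (Rmult_1_l _).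
    exact (is_derive_comp g (fun z => z + e) th _ _ Hg' (Hsh th)).
Qed.

Lemma continuity_2d_pt_rotate (F : R -> R -> R) (t th e : R) :
  continuity_2d_pt F t (th + e) ->
  continuity_2d_pt (fun s ph => F s (ph + e)) t th.
Proof.
  intros H eps; destruct (H eps) as [d Hd]; exists d.
  intros s ph Hs Hph; apply Hd; [exact Hs |].
  replace (ph + e - (th + e)) with (ph - th) by ring; exact Hph.
Qed.

(** In the coordinates [t = ln r] and [th] this is [r^k sin (kap (th - th0))],
    which is harmonic for [k = kap], strictly subharmonic where it is positive
    for [k > kap], and strictly superharmonic there for [k < kap].  The room
    between [k] and [kap] absorbs the zeroth order term for small [r]. *)
Definition wedge (k kap th0 t th : R) : R := exp (k * t) * sin (kap * (th - th0)).

Lemma is_lap_wedge (k kap th0 t th : R) :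
  is_lap (wedge k kap th0) t th ((k ^ 2 - kap ^ 2) * wedge k kap th0 t th).
Proof.
  unfold wedge.
  exists (k ^ 2 * (exp (k * t) * sin (kap * (th - th0)))),
    (- kap ^ 2 * (exp (k * t) * sin (kap * (th - th0)))); repeat split.
  - exists (fun s => k * exp (k * s) * sin (kap * (th - th0))); split.
    + apply filter_forall; intros s; auto_derive; [exact I | unfold Rminus; ring].
    + auto_derive; [exact I | unfold Rminus; ring].
  - exists (fun ph => kap * exp (k * t) * cos (kap * (ph - th0))); split.
    + apply filter_forall; intros s; auto_derive; [exact I | unfold Rminus; ring].
    + auto_derive; [exact I | unfold Rminus; ring].
  - ring.
Qed.

Lemma continuity_2d_pt_wedge (k kap th0 t th : R) :
  continuity_2d_pt (wedge k kap th0) t th.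
Proof.
  unfold wedge; apply continuity_2d_pt_mult.
  - apply (continuity_1d_2d_pt_comp (fun s => exp (k * s)) (fun s _ => s)).
    + apply continuity_pt_filterlim, (ex_derive_continuous (fun s => exp (k * s))).
      auto_derive; exact I.
    + apply continuity_2d_pt_id1.
  - apply (continuity_1d_2d_pt_comp (fun s => sin (kap * (s - th0))) (fun _ s => s)).
    + apply continuity_pt_filterlim,
        (ex_derive_continuous (fun s => sin (kap * (s - th0)))).
      auto_derive; exact I.
    + apply continuity_2d_pt_id2.
Qed.

(** [U] is a solution written in the coordinates [t = ln r] and [th] on a half
    disc with [r <= exp T], and [W] is its angular derivative.  The Lipschitz
    bound compares only points on a common circle, since only rotated copies
    of [U] are compared. *)
Record angular_solution (f : R -> R) (L M T : R) (U W : R -> R -> R) : Prop := {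
  ang_eq : forall t th, t <= T -> 0 < th < PI ->
    is_lap U t th (- exp (2 * t) * f (U t th));
  ang_cont : forall t th, t <= T -> 0 < th < PI -> continuity_2d_pt U t th;
  ang_deriv : forall t th, t <= T -> 0 < th < PI -> is_derive (U t) th (W t th);
  ang_deriv_cont : forall t th, t <= T -> 0 < th < PI -> continuity_2d_pt W t th;
  ang_lip_pos : 0 <= L;
  ang_lip : forall t th ph, t <= T -> 0 < th < PI -> 0 < ph < PI ->
    Rabs (f (U t th) - f (U t ph)) <= L * Rabs (U t th - U t ph);
  ang_small : forall t th, t <= T -> 0 < th < PI -> Rabs (W t th) <= M * exp t
}.

Lemma sin_lower_bound (p q : R) : 0 < p -> p <= q -> q < PI ->
  exists m, 0 < m /\ forall th, p <= th <= q -> m <= sin th.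
Proof.
  intros Hp Hpq Hq.
  destruct (continuity_ab_min sin p q Hpq) as [x [H1 H2]].
  - intros c _; apply continuity_sin.
  - exists (sin x); split; [apply sin_gt_0; lra | exact H1].
Qed.

Lemma exp_small (A k eps : R) : 0 < k -> 0 < eps ->
  exists t0, forall t, t <= t0 -> A * exp (k * t) <= eps.
Proof.
  intros Hk He.
  assert (HA : 0 < Rabs A + 1) by (assert (H := Rabs_pos A); lra).
  exists (ln (eps / (Rabs A + 1)) / k); intros t Ht.
  assert (H : exp (k * t) <= eps / (Rabs A + 1)).
  { rewrite <- (exp_ln (eps / (Rabs A + 1))) by now apply Rdiv_lt_0_compat.
    destruct Ht as [Ht | ->].
    - left; apply exp_increasing.
      apply Rmult_lt_compat_l with (r := k) in Ht; [| exact Hk].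
      replace (k * (ln (eps / (Rabs A + 1)) / k))
        with (ln (eps / (Rabs A + 1))) in Ht by (field; lra); exact Ht.
    - right; f_equal; field; lra. }
  assert (H0 := exp_pos (k * t)); assert (H1 := Rle_abs A).
  apply Rle_trans with ((Rabs A + 1) * exp (k * t)); [nra |].
  apply Rle_trans with ((Rabs A + 1) * (eps / (Rabs A + 1))); [nra |].
  right; field; lra.
Qed.

(** The comparison principle for [W] on a full conical neighbourhood
    [t <= T'] of the apex.  No boundary condition is imposed at the apex:
    there [W] and [b] both tend to zero, and a small multiple of the positive
    supersolution [sin th] is added to [s] to dominate them.  The same
    multiple absorbs the error made in replacing [W] by the difference quotient
    [Z] of [U] under a small rotation, to which
    [comparison_on_rectangle] applies. *)
Lemma comparison_on_half_strip (f : R -> R) (L M T : R) (U W b s lb ls : R -> R -> R)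
    (T' p q : R) :
  angular_solution f L M T U W ->
  T' <= T -> 0 < p -> p <= q -> q < PI -> L * exp (2 * T') < 1 ->
  (forall t th, t <= T' -> p <= th <= q ->
     continuity_2d_pt b t th /\ continuity_2d_pt s t th /\
     0 <= b t th /\ 0 <= s t th /\
     is_lap b t th (lb t th) /\ is_lap s t th (ls t th) /\
     L * exp (2 * t) * b t th <= lb t th /\
     ls t th <= - (L * exp (2 * t)) * s t th) ->
  (forall eps, 0 < eps -> exists t0, forall t th, t <= t0 -> p <= th <= q ->
     b t th <= eps) ->
  (forall t, t <= T' -> b t p - s t p <= W t p /\ b t q - s t q <= W t q) ->
  (forall th, p <= th <= q -> b T' th - s T' th <= W T' th) ->
  forall t th, t <= T' -> p <= th <= q -> b t th - s t th <= W t th.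
Proof.
  intros HU HT Hp Hpq Hq HL Hbs Hb0 Hside Htop t th Ht Hth.
  apply Rnot_lt_le; intros Hneg.
  destruct (sin_lower_bound p q Hp Hpq Hq) as [m [Hm Hsin]].
  (* The total loss is [eta * sin th + eta * m / 2], at most [3 / 2 * eta], and
     the assumed violation is [2 * eta]. *)
  set (eta := (b t th - s t th - W t th) / 2).
  assert (Heta : 0 < eta) by (unfold eta; lra).
  assert (Hem : 0 < eta * m / 2) by nra.
  destruct (Hb0 (eta * m / 4) ltac:(lra)) as [tb Htb].
  destruct (exp_small M 1 (eta * m / 4) ltac:(lra) ltac:(lra)) as [tM HtM].
  set (t1 := Rmin t (Rmin tb tM)).
  assert (Ht1 : t1 <= t /\ t1 <= tb /\ t1 <= tM).
  { unfold t1; assert (H1 := Rmin_l t (Rmin tb tM)).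
    assert (H2 := Rmin_r t (Rmin tb tM)).
    assert (H3 := Rmin_l tb tM); assert (H4 := Rmin_r tb tM); lra. }
  set (q' := (q + PI) / 2).
  destruct (uniform_continuity_2d W t1 T' p q') with (eps := mkposreal _ Hem)
    as [d Hd].
  { intros x y Hx Hy; apply (ang_deriv_cont _ _ _ _ _ _ HU); unfold q' in *; lra. }
  assert (Hdpos := cond_pos d); simpl in Hd.
  set (e := Rmin d (q' - q) / 2).
  assert (He : 0 < e /\ e < d /\ e < q' - q).
  { assert (Hq' : 0 < q' - q) by (unfold q'; lra).
    assert (H1 := Rmin_l d (q' - q)); assert (H2 := Rmin_r d (q' - q)).
    assert (H3 := Rmin_pos d (q' - q) Hdpos Hq'); unfold e; lra. }
  assert (Hq'pi : q' < PI) by (unfold q'; lra).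
  set (Z := fun x y => / e * (U x (y + e) + -1 * U x y)).
  (* By the mean value theorem the quotient is a value of [W] at an angle
     within [e] of [y]. *)
  assert (HZW : forall x y, t1 <= x <= T' -> p <= y <= q ->
            Rabs (Z x y - W x y) < eta * m / 2).
  { intros x y Hx Hy.
    destruct (MVT_cor2 (U x) (W x) y (y + e)) as [c [Hc1 Hc2]]; [lra | |].
    { intros c Hc; apply is_derive_Reals, (ang_deriv _ _ _ _ _ _ HU); lra. }
    replace (Z x y) with (W x c).
    - apply Hd; try lra.
      + rewrite Rminus_diag, Rabs_R0; exact Hdpos.
      + apply Rabs_def1; lra.
    - unfold Z; replace (U x (y + e) + -1 * U x y) with (W x c * e) by lra.
      field; lra. }
  assert (Hcmp : b t th - (s t th + eta * wedge 0 1 0 t th) <= Z t th).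
  { assert (Hw : forall x y, wedge 0 1 0 x y = sin y).
    { intros x y; unfold wedge.
      rewrite Rmult_0_l, exp_0, !Rmult_1_l, Rminus_0_r; reflexivity. }
    apply (comparison_on_rectangle
      (fun x y => L * exp (2 * x)) Z b (fun x y => s x y + eta * wedge 0 1 0 x y)
      (fun x y => / e * (- exp (2 * x) * f (U x (y + e)) +
                          -1 * (- exp (2 * x) * f (U x y))))
      lb (fun x y => ls x y + eta * ((0 ^ 2 - 1 ^ 2) * wedge 0 1 0 x y))
      t1 T' p q); try lra.
    - intros x y Hx Hy.
      destruct (Hbs x y) as [Cb [Cs [Pb [Ps _]]]]; [lra | lra |].
      repeat split; try assumption.
      + apply continuity_2d_pt_mult; [apply continuity_2d_pt_const |].
        apply continuity_2d_pt_plus.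
        * apply continuity_2d_pt_rotate, (ang_cont _ _ _ _ _ _ HU); lra.
        * apply continuity_2d_pt_mult; [apply continuity_2d_pt_const |].
          apply (ang_cont _ _ _ _ _ _ HU); lra.
      + apply continuity_2d_pt_plus; [exact Cs |].
        apply continuity_2d_pt_mult; [apply continuity_2d_pt_const |].
        apply continuity_2d_pt_wedge.
      + rewrite Hw; specialize (Hsin y Hy); nra.
    - intros x y Hx Hy.
      destruct (Hbs x y) as [_ [_ [Pb [Ps [Lb [Ls [Ib Is]]]]]]]; [lra | lra |].
      assert (HLx : 0 <= L * exp (2 * x) < 1).
      { assert (H0 := ang_lip_pos _ _ _ _ _ _ HU).
        assert (H1 := exp_pos (2 * x)).
        assert (H2 : exp (2 * x) < exp (2 * T')) by (apply exp_increasing; lra).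
        nra. }
      repeat split.
      + apply is_lap_scal, is_lap_plus.
        * apply is_lap_rotate, (ang_eq _ _ _ _ _ _ HU); lra.
        * apply is_lap_scal, (ang_eq _ _ _ _ _ _ HU); lra.
      + exact Lb.
      + apply is_lap_plus; [exact Ls | apply is_lap_scal, is_lap_wedge].
      + unfold Z.
        replace (- exp (2 * x) * f (U x (y + e)) + -1 * (- exp (2 * x) * f (U x y)))
          with (- exp (2 * x) * (f (U x (y + e)) - f (U x y))) by ring.
        rewrite !Rabs_mult, Rabs_Ropp, (Rabs_pos_eq (exp _)) by (left; apply exp_pos).
        replace (U x (y + e) + -1 * U x y) with (U x (y + e) - U x y) by ring.
        assert (HLip := ang_lip _ _ _ _ _ _ HU x (y + e) y
                          ltac:(lra) ltac:(lra) ltac:(lra)).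
        apply Rle_trans with
          (Rabs (/ e) * (exp (2 * x) * (L * Rabs (U x (y + e) - U x y)))).
        * apply Rmult_le_compat_l; [apply Rabs_pos |].
          apply Rmult_le_compat_l; [left; apply exp_pos | exact HLip].
        * right; ring.
      + exact Ib.
      + rewrite Hw; specialize (Hsin y ltac:(lra)).
        assert (0 < eta * sin y) by nra; nra.
      + apply HLx.
    - intros x y Hx Hy Hbd; rewrite Hw.
      assert (HZ := Rabs_def2 _ _ (HZW x y Hx Hy)).
      assert (Hs := Hsin y Hy).
      assert (eta * m <= eta * sin y) by nra.
      destruct (Hbs x y) as [_ [_ [_ [Ps _]]]]; [lra | lra |].
      destruct Hbd as [-> | [-> | [-> | ->]]].
      + specialize (Htb t1 y ltac:(lra) Hy).
        specialize (HtM t1 ltac:(lra)); rewrite Rmult_1_l in HtM.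
        assert (HW := ang_small _ _ _ _ _ _ HU t1 y ltac:(lra) ltac:(lra)).
        assert (HW' := Rcomplements.Rabs_maj2 (W t1 y)).
        lra.
      + specialize (Htop y Hy); lra.
      + specialize (Hside x ltac:(lra)); lra.
      + specialize (Hside x ltac:(lra)); lra. }
  assert (HZ := Rabs_def2 _ _ (HZW t th ltac:(lra) Hth)).
  assert (H1 := SIN_bound th); assert (H2 := Hsin th Hth).
  assert (Hw : wedge 0 1 0 t th = sin th).
  { unfold wedge; rewrite Rmult_0_l, exp_0, !Rmult_1_l, Rminus_0_r; reflexivity. }
  rewrite Hw in Hcmp.
  assert (eta * sin th + eta * m / 2 <= 3 / 2 * eta) by nra.
  unfold eta in *; lra.
Qed.

(** * Positivity in cones *)

Lemma exp_small_below (A k eps T : R) : 0 < k -> 0 < eps ->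
  exists t0, t0 <= T /\ forall t, t <= t0 -> A * exp (k * t) <= eps.
Proof.
  intros Hk He; destruct (exp_small A k eps Hk He) as [t0 Ht0].
  exists (Rmin t0 T); split; [apply Rmin_r |].
  intros t Ht; apply Ht0; assert (H := Rmin_l t0 T); lra.
Qed.

Lemma wedge_le_exp (A k kap th0 t th : R) : 0 <= A ->
  A * wedge k kap th0 t th <= A * exp (k * t).
Proof.
  intros HA; unfold wedge; assert (H := SIN_bound (kap * (th - th0))).
  assert (H0 := exp_pos (k * t)).
  apply Rmult_le_compat_l; [exact HA | nra].
Qed.

Lemma continuity_2d_pt_scal_wedge (A k kap th0 t th : R) :
  continuity_2d_pt (fun x y => A * wedge k kap th0 x y) t th.
Proof.
  apply continuity_2d_pt_mult;
    [apply continuity_2d_pt_const | apply continuity_2d_pt_wedge].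
Qed.

(** The subsolution [wedge k kap p] vanishes on both sides of the cone, where
    [W] is positive, and a small multiple of it lies below the positive
    minimum of [W] on an outer arc.  It is a subsolution because
    [k > kap = PI / (q - p)]. *)
Lemma cone_lower_bound (f : R -> R) (L M T : R) (U W : R -> R -> R) (T1 p q k : R) :
  angular_solution f L M T U W ->
  T1 <= T -> 0 < p -> p < q -> q < PI -> PI / (q - p) < k ->
  (forall t th, t <= T1 -> p <= th <= q -> 0 < W t th) ->
  exists A T2, 0 < A /\ T2 <= T1 /\ forall t th, t <= T2 -> p <= th <= q ->
    A * wedge k (PI / (q - p)) p t th <= W t th.
Proof.
  intros HU HT Hp Hpq Hq Hk HW.
  set (kap := PI / (q - p)) in *.
  assert (Hpi := PI_RGT_0).
  assert (Hkap : 0 < kap) by (apply Rdiv_lt_0_compat; lra).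
  assert (Hkq : kap * (q - p) = PI) by (unfold kap; field; lra).
  assert (HL := ang_lip_pos _ _ _ _ _ _ HU).
  assert (Hgap : 0 < Rmin (1 / 2) (k ^ 2 - kap ^ 2)) by (apply Rmin_pos; nra).
  destruct (exp_small_below L 2 _ T1 ltac:(lra) Hgap) as [T2 [HT2 HLT2]].
  assert (Hm1 := Rmin_l (1 / 2) (k ^ 2 - kap ^ 2)).
  assert (Hm2 := Rmin_r (1 / 2) (k ^ 2 - kap ^ 2)).
  destruct (rectangle_min W T2 T2 p q) as [t0 [h0 [Ht0 [Hh0 Hmin]]]]; try lra.
  { intros t th H1 H2; apply (ang_deriv_cont _ _ _ _ _ _ HU); lra. }
  assert (Hmu : 0 < W t0 h0) by (apply HW; lra).
  assert (Hsin : forall th, p <= th <= q -> 0 <= sin (kap * (th - p))).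
  { intros th Hth; apply sin_ge_0; nra. }
  exists (W t0 h0 * exp (- (k * T2))), T2.
  assert (HA : 0 < W t0 h0 * exp (- (k * T2))).
  { apply Rmult_lt_0_compat; [exact Hmu | apply exp_pos]. }
  set (A := W t0 h0 * exp (- (k * T2))) in *.
  repeat split; [exact HA | exact HT2 |].
  intros t th Ht Hth.
  replace (A * wedge k kap p t th)
    with (A * wedge k kap p t th - 0 * wedge 0 1 0 t th) by ring.
  apply (comparison_on_half_strip f L M T U W
    (fun x y => A * wedge k kap p x y) (fun x y => 0 * wedge 0 1 0 x y)
    (fun x y => A * ((k ^ 2 - kap ^ 2) * wedge k kap p x y))
    (fun x y => 0 * ((0 ^ 2 - 1 ^ 2) * wedge 0 1 0 x y)) T2 p q HU); try lra.
  - specialize (HLT2 T2 ltac:(lra)); lra.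
  - intros x y Hx Hy; specialize (HLT2 x Hx).
    assert (Hw : 0 <= wedge k kap p x y).
    { unfold wedge; apply Rmult_le_pos; [left; apply exp_pos | now apply Hsin]. }
    repeat split; try apply continuity_2d_pt_scal_wedge;
      try (apply is_lap_scal, is_lap_wedge).
    + nra.
    + lra.
    + assert (L * exp (2 * x) * wedge k kap p x y
              <= (k ^ 2 - kap ^ 2) * wedge k kap p x y)
        by (apply Rmult_le_compat_r; lra).
      nra.
    + lra.
  - intros eps Heps.
    destruct (exp_small A k eps) as [tb Htb]; [lra | lra |].
    exists tb; intros x y Hx _.
    eapply Rle_trans; [apply wedge_le_exp; lra | now apply Htb].
  - intros x Hx; unfold wedge.
    rewrite Rminus_diag, Rmult_0_r, sin_0, Hkq, sin_PI.
    assert (H1 := HW x p ltac:(lra) ltac:(lra)).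
    assert (H2 := HW x q ltac:(lra) ltac:(lra)); lra.
  - intros y Hy; specialize (Hmin T2 y ltac:(lra) Hy).
    assert (H := wedge_le_exp A k kap p T2 y ltac:(lra)).
    assert (HA' : A * exp (k * T2) = W t0 h0).
    { unfold A; rewrite Rmult_assoc, <- exp_plus.
      replace (- (k * T2) + k * T2) with 0 by ring; rewrite exp_0; ring. }
    lra.
Qed.

(** The subsolution is [A r^k sin (kap (q - th))] with [kap < k], controlled by
    the lower bound on the ray [p] and vanishing on the ray [q].  It need not be
    below [W] on the outer arc; a large multiple of the supersolution
    [r^l sin (lam (th - ph0))] is subtracted to make it so.  Because
    [k < PI / (q - p)] there is room for [k < l < lam < PI / (q - p)]: the
    correction is positive up to both sides and of higher order than [r^k].
    The bound thus obtained is positive near the apex, away from the ray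
    [q]. *)
Lemma positive_across_gap (f : R -> R) (L M T : R) (U W : R -> R -> R)
    (T1 p q k A sig : R) :
  angular_solution f L M T U W ->
  T1 <= T -> 0 < p -> p < q -> q < PI -> 0 < k -> k < PI / (q - p) ->
  0 < A -> 0 < sig ->
  (forall t, t <= T1 -> A * exp (k * t) <= W t p) ->
  (forall t, t <= T1 -> 0 <= W t q) ->
  exists T2, T2 <= T1 /\
    forall t th, t <= T2 -> p <= th <= q - sig -> 0 < W t th.
Proof.
  intros HU HT Hp Hpq Hq Hk0 Hk HA Hsig HWp HWq.
  assert (Hpi := PI_RGT_0).
  set (kap := k / 2).
  set (l := (2 * k + PI / (q - p)) / 3).
  set (lam := (k + 2 * (PI / (q - p))) / 3).
  assert (Hpq0 : PI / (q - p) * (q - p) = PI) by (field; lra).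
  assert (Hkl : k < l < lam) by (unfold l, lam; lra).
  assert (Hlam : lam * (q - p) < PI).
  { rewrite <- Hpq0; apply Rmult_lt_compat_r; [lra | unfold lam; lra]. }
  assert (Hkap : 0 < kap < k) by (unfold kap; lra).
  assert (Hkq : kap * (q - p) < PI) by nra.
  (* The phases: the sine in the subsolution vanishes at the angle [q], and that
     in the supersolution is largest at the middle of the gap. *)
  set (th0 := q - PI / kap).
  assert (Hb : forall th, kap * (th - th0) = PI - kap * (q - th)).
  { intros th; unfold th0; field; lra. }
  set (ph0 := (p + q) / 2 - PI / 2 / lam).
  assert (Hs : forall th, lam * (th - ph0) = PI / 2 + lam * (th - (p + q) / 2)).
  { intros th; unfold ph0; field; lra. }
  destruct (sin_lower_bound (lam * (p - ph0)) (lam * (q - ph0)))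
    as [m [Hm Hsin]]; try (rewrite ?Hs; nra).
  assert (Hsin' : forall th, p <= th <= q -> m <= sin (lam * (th - ph0))).
  { intros th Hth; apply Hsin; nra. }
  assert (Hsinb : forall th, p <= th <= q -> 0 <= sin (kap * (th - th0)) <= 1).
  { intros th Hth; split; [| apply SIN_bound].
    rewrite Hb, sin_PI_x; apply sin_ge_0; nra. }
  assert (HL := ang_lip_pos _ _ _ _ _ _ HU).
  set (g := Rmin (1 / 2) (Rmin (k ^ 2 - kap ^ 2) (lam ^ 2 - l ^ 2))).
  assert (Hg : 0 < g) by (unfold g; repeat apply Rmin_pos; nra).
  assert (Hg' : g <= 1 / 2 /\ g <= k ^ 2 - kap ^ 2 /\ g <= lam ^ 2 - l ^ 2).
  { unfold g; assert (H1 := Rmin_l (1 / 2) (Rmin (k ^ 2 - kap ^ 2) (lam ^ 2 - l ^ 2))).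
    assert (H2 := Rmin_r (1 / 2) (Rmin (k ^ 2 - kap ^ 2) (lam ^ 2 - l ^ 2))).
    assert (H3 := Rmin_l (k ^ 2 - kap ^ 2) (lam ^ 2 - l ^ 2)).
    assert (H4 := Rmin_r (k ^ 2 - kap ^ 2) (lam ^ 2 - l ^ 2)); lra. }
  destruct (exp_small_below L 2 g T1 ltac:(lra) Hg) as [T2 [HT2 HLT2]].
  set (B := (A * exp (k * T2) + Rabs M * exp T2) / (m * exp (l * T2))).
  assert (HeT := exp_pos (l * T2)); assert (HekT := exp_pos (k * T2)).
  assert (HeT1 := exp_pos T2); assert (HM := Rabs_pos M).
  assert (HB : 0 <= B).
  { unfold B; apply Rdiv_le_0_compat; nra. }
  assert (HBeq : B * exp (l * T2) * m = A * exp (k * T2) + Rabs M * exp T2).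
  { unfold B; field; lra. }
  assert (Hlow : forall t th, t <= T2 -> p <= th <= q ->
    A * wedge k kap th0 t th - B * wedge l lam ph0 t th <= W t th).
  { apply (comparison_on_half_strip f L M T U W
      (fun x y => A * wedge k kap th0 x y) (fun x y => B * wedge l lam ph0 x y)
      (fun x y => A * ((k ^ 2 - kap ^ 2) * wedge k kap th0 x y))
      (fun x y => B * ((l ^ 2 - lam ^ 2) * wedge l lam ph0 x y)) T2 p q HU);
      try lra.
    - specialize (HLT2 T2 ltac:(lra)); lra.
    - intros x y Hx Hy; specialize (HLT2 x Hx).
      assert (Hwb : 0 <= wedge k kap th0 x y).
      { unfold wedge; apply Rmult_le_pos;
          [left; apply exp_pos | now apply Hsinb]. }
      assert (Hws : 0 <= wedge l lam ph0 x y).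
      { unfold wedge; apply Rmult_le_pos; [left; apply exp_pos |].
        specialize (Hsin' y Hy); lra. }
      repeat split; try apply continuity_2d_pt_scal_wedge;
        try (apply is_lap_scal, is_lap_wedge).
      + nra.
      + nra.
      + assert (L * exp (2 * x) * wedge k kap th0 x y
                <= (k ^ 2 - kap ^ 2) * wedge k kap th0 x y)
          by (apply Rmult_le_compat_r; lra).
        nra.
      + assert (L * exp (2 * x) * wedge l lam ph0 x y
                <= (lam ^ 2 - l ^ 2) * wedge l lam ph0 x y)
          by (apply Rmult_le_compat_r; lra).
        nra.
    - intros eps Heps.
      destruct (exp_small A k eps) as [tb Htb]; [lra | lra |].
      exists tb; intros x y Hx _.
      eapply Rle_trans; [apply wedge_le_exp; lra | now apply Htb].
    - intros x Hx; split.
      + specialize (HWp x ltac:(lra)).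
        assert (H1 := wedge_le_exp A k kap th0 x p ltac:(lra)).
        assert (H2 : 0 <= wedge l lam ph0 x p).
        { unfold wedge; apply Rmult_le_pos; [left; apply exp_pos |].
          specialize (Hsin' p ltac:(lra)); lra. }
        nra.
      + specialize (HWq x ltac:(lra)).
        assert (H1 : wedge k kap th0 x q = 0).
        { unfold wedge; rewrite Hb, sin_PI_x, Rminus_diag, Rmult_0_r, sin_0; ring. }
        assert (H2 : 0 <= wedge l lam ph0 x q).
        { unfold wedge; apply Rmult_le_pos; [left; apply exp_pos |].
          specialize (Hsin' q ltac:(lra)); lra. }
        nra.
    - intros y Hy.
      assert (H1 := wedge_le_exp A k kap th0 T2 y ltac:(lra)).
      assert (H2 := ang_small _ _ _ _ _ _ HU T2 y ltac:(lra) ltac:(lra)).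
      assert (H3 := Rcomplements.Rabs_maj2 (W T2 y)).
      assert (H4 : M * exp T2 <= Rabs M * exp T2).
      { apply Rmult_le_compat_r; [lra | apply Rle_abs]. }
      assert (H5 : B * exp (l * T2) * m <= B * wedge l lam ph0 T2 y).
      { unfold wedge; rewrite Rmult_assoc.
        apply Rmult_le_compat_l; [exact HB |].
        apply Rmult_le_compat_l; [lra | now apply Hsin']. }
      lra. }
  destruct (Rlt_or_le (q - sig) p) as [Hvoid | Hsp].
  { exists T2; split; [exact HT2 | intros t th _ Hth; lra]. }
  destruct (sin_lower_bound (kap * sig) (kap * (q - p))) as [m2 [Hm2 Hsin2]];
    try nra.
  destruct (exp_small_below B (l - k) (A * m2 / 2) T2) as [T3 [HT3 HBT3]];
    [lra | nra |].
  exists T3; split; [lra |].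
  intros t th Ht Hth; specialize (HBT3 t Ht).
  assert (H1 := Hlow t th ltac:(lra) ltac:(lra)).
  assert (H2 := wedge_le_exp B l lam ph0 t th HB).
  assert (H3 : m2 <= sin (kap * (th - th0))).
  { rewrite Hb, sin_PI_x; apply Hsin2; nra. }
  assert (H4 : exp (l * t) = exp (k * t) * exp ((l - k) * t)).
  { rewrite <- exp_plus; f_equal; ring. }
  assert (H5 := exp_pos (k * t)).
  assert (H6 : A * wedge k kap th0 t th >= A * exp (k * t) * m2).
  { unfold wedge; rewrite <- Rmult_assoc.
    apply Rle_ge, Rmult_le_compat_l; nra. }
  assert (H7 : B * exp (l * t) <= exp (k * t) * (A * m2 / 2)).
  { rewrite H4; nra. }
  assert (H8 : 0 < exp (k * t) * (A * m2)) by (repeat apply Rmult_lt_0_compat; lra).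
  lra.
Qed.

(** A cone of opening greater than [PI / 2] allows an exponent [k < 2] in
    [cone_lower_bound], against the upper bound [M2 r^2]. *)
Lemma no_positive_wide_cone (f : R -> R) (L M M2 T : R) (U W : R -> R -> R) (T1 q : R) :
  angular_solution f L M T U W ->
  (forall t th, t <= T -> 0 < th < PI -> W t th <= M2 * exp (2 * t)) ->
  T1 <= T -> PI / 2 < q -> q < PI ->
  (forall t th, t <= T1 -> 0 < th <= q -> 0 < W t th) -> False.
Proof.
  intros HU HM2 HT Hq Hqpi HW.
  assert (Hpi := PI_RGT_0).
  set (p := (q - PI / 2) / 2).
  assert (Hp : 0 < p < q /\ PI / 2 < q - p) by (unfold p; lra).
  set (k := (2 + PI / (q - p)) / 2).
  assert (Hk2 : PI / (q - p) < 2).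
  { apply Rmult_lt_reg_r with (q - p); [lra |].
    unfold Rdiv; rewrite Rmult_assoc, Rinv_l; lra. }
  destruct (cone_lower_bound f L M T U W T1 p q k HU) as [A [T2 [HA [HT2 Hlow]]]];
    try (unfold k; lra).
  { intros t th Ht Hth; apply HW; lra. }
  destruct (exp_small_below M2 (2 - k) (A / 2) T2) as [t [Ht Hsm]];
    [unfold k; lra | lra |].
  specialize (Hsm t ltac:(lra)).
  specialize (Hlow t ((p + q) / 2) Ht ltac:(lra)).
  specialize (HM2 t ((p + q) / 2) ltac:(lra) ltac:(lra)).
  unfold wedge in Hlow.
  replace (PI / (q - p) * ((p + q) / 2 - p)) with (PI / 2) in Hlow by (field; lra).
  rewrite sin_PI2 in Hlow.
  replace (2 * t) with (k * t + (2 - k) * t) in HM2 by ring.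
  rewrite exp_plus in HM2.
  assert (H := exp_pos (k * t)); nra.
Qed.

(** When [a < b], these are the ends of the gap.  With [tau = (2 a - b) / 4] the
    cone from [tau] to [a] is still wider than the gap enlarged to reach from
    [a - tau] to [b + tau], so that an exponent fits between
    [PI / (a - tau)] and [PI] over the width of the enlarged gap.  Its upper
    ray is cut off at [c], where positivity is known no further. *)
Lemma no_critical_boundary_point (f : R -> R) (L M M2 T : R) (U W : R -> R -> R) (a b c : R) :
  angular_solution f L M T U W ->
  (forall t th, t <= T -> 0 < th < PI -> W t th <= M2 * exp (2 * t)) ->
  0 < a -> b < 2 * a -> b <= c -> PI / 2 < c -> c < PI ->
  (forall t th, t <= T -> 0 < th < PI -> th <= a \/ b <= th <= c -> 0 < W t th) ->
  False.
Proof.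
  intros HU HM2 Ha Hba Hbc Hc Hcpi HW.
  destruct (Rle_or_lt b a) as [Hle | Hab].
  { apply (no_positive_wide_cone f L M M2 T U W T c HU HM2); try lra.
    intros t th Ht Hth; apply HW; [exact Ht | lra |].
    destruct (Rle_or_lt th a); [now left | right; lra]. }
  assert (Hpi := PI_RGT_0).
  set (tau := (2 * a - b) / 4).
  assert (Htau : 0 < tau /\ 4 * tau < a) by (unfold tau; lra).
  set (q := Rmin c (b + tau)).
  assert (Hq : b <= q <= c /\ q <= b + tau).
  { unfold q; assert (H1 := Rmin_l c (b + tau)); assert (H2 := Rmin_r c (b + tau)).
    assert (H3 := Rmin_glb c (b + tau) b Hbc ltac:(lra)); lra. }
  assert (Hw : q - (a - tau) < a - tau) by (unfold tau in *; lra).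
  set (k := (PI / (a - tau) + PI / (q - (a - tau))) / 2).
  assert (Hk : 0 < PI / (a - tau) < PI / (q - (a - tau))).
  { split; [apply Rdiv_lt_0_compat; lra |].
    apply Rmult_lt_compat_l; [lra |].
    apply Rinv_lt_contravar; [apply Rmult_lt_0_compat |]; lra. }
  destruct (cone_lower_bound f L M T U W T tau a k HU) as [A [T2 [HA [HT2 Hlow]]]];
    try (unfold k; lra).
  { intros t th Ht Hth; apply HW; lra. }
  set (z := sin (PI / (a - tau) * (a - tau - tau))).
  assert (Hz : 0 < z).
  { unfold z.
    assert (H : PI / (a - tau) * (a - tau) = PI) by (field; lra).
    apply sin_gt_0; nra. }
  (* Positivity across the gap is only obtained up to [q - sig].  If [q = b + tau]
     that is [b], and the known cone from [b] to [c] takes over; if [q = c]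
     it must still exceed [PI / 2]. *)
  set (sig := if Rlt_dec c (b + tau) then (c - PI / 2) / 2 else tau).
  assert (Hsig : 0 < sig) by (unfold sig; destruct Rlt_dec; lra).
  destruct (positive_across_gap f L M T U W T2 (a - tau) q k (A * z) sig HU)
    as [T3 [HT3 Hpos]]; try (unfold k; lra).
  - nra.
  - intros t Ht; specialize (Hlow t (a - tau) Ht ltac:(lra)).
    unfold wedge in Hlow; fold z in Hlow; lra.
  - intros t Ht; left; apply HW; lra.
  - set (c1 := if Rlt_dec c (b + tau) then (PI / 2 + c) / 2 else c).
    apply (no_positive_wide_cone f L M M2 T U W T3 c1 HU HM2); try lra.
    + unfold c1; destruct Rlt_dec; lra.
    + unfold c1; destruct Rlt_dec; lra.
    + intros t th Ht Hth.
      destruct (Rle_or_lt th a) as [Hta | Hta].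
      { apply HW; lra. }
      destruct (Rle_or_lt th (q - sig)) as [Htq | Htq]; [apply Hpos; lra |].
      unfold c1, sig, q in *; destruct Rlt_dec as [Hlt | Hnlt].
      * rewrite Rmin_left in Htq by lra; lra.
      * rewrite Rmin_right in Htq by lra; apply HW; lra.
Qed.

(** * Geometry of the sector *)

Lemma sector_trig (alpha beta : R) : 0 < beta -> beta < alpha -> alpha <= PI ->
  0 < sin (beta / 2) /\ 0 < cos (beta / 2) /\ 0 < sin (alpha / 2) /\
  0 <= cos (alpha / 2) /\ 0 < sin ((alpha - beta) / 2) /\
  0 < cos ((alpha - beta) / 2).
Proof.
  intros Hb Hab Ha; assert (Hpi := PI_RGT_0); repeat split.
  - apply sin_gt_0; lra.
  - apply cos_gt_0; lra.
  - apply sin_gt_0; lra.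
  - apply cos_ge_0; lra.
  - apply sin_gt_0; lra.
  - apply cos_gt_0; lra.
Qed.

(** This is the formula for [cot (2 y)] with [y = arccot X]. *)
Lemma atan_of_double_cot (X : R) : 0 < X ->
  atan ((X ^ 2 - 1) / (2 * X)) = 2 * atan X - PI / 2.
Proof.
  intros HX.
  assert (H0 : 0 < atan X) by (rewrite <- atan_0; now apply atan_increasing).
  assert (H1 := atan_bound X).
  rewrite <- (atan_tan (2 * atan X - PI / 2)) by lra; f_equal.
  assert (Hs : 0 < sin (atan X)) by (apply sin_gt_0; lra).
  assert (Hc : 0 < cos (atan X)) by (apply cos_gt_0; lra).
  rewrite <- (tan_atan X) at 1 2; unfold tan.
  rewrite sin_minus, cos_minus, sin_PI2, cos_PI2, sin_2a, cos_2a; field; lra.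
Qed.

(** The gap between the rays from [P] to [O] and to [P_+] is narrower than
    [theta_A].  In terms of the cotangents [X] and [Y] of the two angles the
    claim is [cot (2 theta_A) < Y]; with [t = |a| cos (beta / 2)], the length
    of the tangents from the vertex to the circle about [O] touching the sides,
    the difference is an explicit positive fraction as
    [lambda < t < l_N]. *)
Lemma theta_B_lt_2_theta_A (alpha beta lambda : R) :
  0 < beta -> beta < alpha -> alpha <= PI -> 0 < lambda ->
  theta_B alpha beta lambda < 2 * theta_A alpha beta lambda.
Proof.
  intros Hb Hab Ha Hl.
  destruct (sector_trig alpha beta Hb Hab Ha) as [HS [HC [HSa [HCa [HSab HCab]]]]].
  unfold theta_B, theta_A, arccot, l_N, sec_a.
  replace (Rabs (- sin ((alpha - beta) / 2) / sin (beta / 2)))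
    with (sin ((alpha - beta) / 2) / sin (beta / 2)).
  2: { unfold Rdiv; rewrite Ropp_mult_distr_l_reverse, Rabs_Ropp, Rabs_pos_eq;
       [reflexivity | left; now apply Rdiv_lt_0_compat]. }
  set (S := sin (beta / 2)) in *; set (C := cos (beta / 2)) in *.
  assert (HSC : S ^ 2 + C ^ 2 = 1).
  { assert (H := sin2_cos2 (beta / 2)); unfold Rsqr in H; fold S C in H; lra. }
  replace (cos beta) with (C * C - S * S).
  2: { unfold S, C; rewrite <- cos_2a; f_equal; field. }
  replace (sin beta) with (2 * S * C).
  2: { unfold S, C; rewrite <- sin_2a; f_equal; field. }
  set (r := sin ((alpha - beta) / 2) / S).
  assert (Hr : 0 < r) by (now apply Rdiv_lt_0_compat).
  set (l := sin (alpha / 2) / S).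
  assert (Hlr : l = r * C + cos ((alpha - beta) / 2)).
  { unfold l, r.
    replace (alpha / 2) with ((alpha - beta) / 2 + beta / 2) by field.
    rewrite sin_plus; fold S C; field; lra. }
  set (X := (r * C - lambda) / (r * S)).
  set (Y := (l * (C * C - S * S) - lambda) / (l * (2 * S * C))).
  assert (HY := atan_bound Y); assert (HX := atan_bound X).
  destruct (Rle_or_lt X 0) as [HX0 | HX0].
  { assert (atan X <= 0).
    { destruct HX0 as [HX0 | HX0].
      - left; rewrite <- atan_0; now apply atan_increasing.
      - rewrite HX0, atan_0; lra. }
    lra. }
  enough (H : 2 * atan X - PI / 2 < atan Y) by lra.
  rewrite <- atan_of_double_cot by exact HX0; apply atan_increasing.
  set (t := r * C) in *.
  assert (Ht : 0 < t < l) by (unfold t in *; nra).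
  assert (Hlt : lambda < t).
  { apply Rnot_le_lt; intros H; apply (Rlt_irrefl 0).
    apply Rlt_le_trans with (1 := HX0); unfold X.
    unfold Rdiv; assert (0 < / (r * S)) by (apply Rinv_0_lt_compat; nra); nra. }
  assert (Hdiff : Y - (X ^ 2 - 1) / (2 * X) =
    lambda * ((t - lambda) * (l - t) + lambda * (l * S ^ 2)) /
    (2 * l * S * C * t * (t - lambda))).
  { assert (Hr' : r = t / C) by (unfold t; field; lra).
    assert (Hnum : lambda * ((t - lambda) * (l - t) + lambda * (l * S ^ 2)) =
      t * (t - lambda) * (l * (C * C - S * S) - lambda) -
      l * (C ^ 2 * (t - lambda) ^ 2 - t ^ 2 * S ^ 2)).
    { replace (C * C) with (1 - S ^ 2) by lra.
      replace (C ^ 2) with (1 - S ^ 2) by lra; ring. }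
    rewrite Hnum; unfold X, Y; rewrite Hr'; field; repeat split; lra. }
  assert (0 < lambda * ((t - lambda) * (l - t) + lambda * (l * S ^ 2)) /
    (2 * l * S * C * t * (t - lambda))).
  { assert (HS2 := pow_lt S 2 HS).
    assert (HlS : 0 < l * S ^ 2) by (apply Rmult_lt_0_compat; lra).
    apply Rdiv_lt_0_compat.
    - apply Rmult_lt_0_compat; [lra |]; apply Rplus_lt_0_compat;
        apply Rmult_lt_0_compat; lra.
    - assert (Hl0 : 0 < l) by lra; assert (Ht0 : 0 < t) by lra.
      assert (Hd : 0 < t - lambda) by lra.
      clear - HS HC Hl0 Ht0 Hd; clearbody l t S C.
      repeat apply Rmult_lt_0_compat; lra. }
  lra.
Qed.

(** Both members are the abscissa of [P_+], which lies on the ray that carries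
    the side and on the arc. *)
Lemma corner_on_ray (alpha beta : R) : 0 < sin (beta / 2) ->
  sin (alpha / 2) * cot (beta / 2) = cos (alpha / 2) - sec_a alpha beta.
Proof.
  intros HS; unfold cot, sec_a.
  replace ((alpha - beta) / 2) with (alpha / 2 - beta / 2) by field.
  rewrite sin_minus; field; lra.
Qed.

Lemma sqrt_one_minus_sin2 (x : R) : 0 <= cos x -> sqrt (1 - sin x ^ 2) = cos x.
Proof.
  intros H; rewrite <- (sqrt_Rsqr (cos x)) by exact H; f_equal.
  assert (E := sin2_cos2 x); unfold Rsqr in *; lra.
Qed.

Lemma locally_positive (g : R * R -> R) (x : R * R) :
  continuous g x -> 0 < g x -> locally x (fun y => 0 < g y).
Proof. intros Hg H; apply (Hg (fun z => 0 < z)), open_gt, H. Qed.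

Lemma closure_nonneg (A : R * R -> Prop) (g : R * R -> R) (x : R * R) :
  continuous g x -> (forall y, A y -> 0 <= g y) -> closure A x -> 0 <= g x.
Proof.
  intros Hg HA Hx; apply Rnot_lt_le; intros Hneg.
  destruct (Hg (fun z => z < 0) (open_lt 0 _ Hneg)) as [d Hd].
  destruct (Hx d) as [y [Hy1 Hy2]].
  specialize (Hd y Hy1); specialize (HA y Hy2); simpl in Hd; lra.
Qed.

Lemma continuous_height (x : R * R) : continuous (fun y : R * R => 1 - Rabs (snd y)) x.
Proof.
  destruct x as [x1 x2].
  apply (continuous_minus (V := R_NormedModule) (fun _ => 1) (fun y : R * R => Rabs (snd y))).
  - apply continuous_const.
  - apply (continuous_comp snd Rabs); [apply continuous_snd | apply continuous_Rabs].
Qed.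

Lemma continuous_above_rays (c : R) (x : R * R) :
  continuous (fun y : R * R => fst y - Rabs (snd y) * c) x.
Proof.
  destruct x as [x1 x2].
  apply (continuous_minus (V := R_NormedModule) fst (fun y : R * R => Rabs (snd y) * c)).
  - apply continuous_fst.
  - apply (continuous_mult (K := R_AbsRing) (fun y : R * R => Rabs (snd y)) (fun _ => c)).
    + apply (continuous_comp snd Rabs); [apply continuous_snd | apply continuous_Rabs].
    + apply continuous_const.
Qed.

Lemma continuous_inside_arc (a : R) (x : R * R) :
  continuous (fun y : R * R => sqrt (1 - snd y ^ 2) - a - fst y) x.
Proof.
  destruct x as [x1 x2].
  apply (continuous_minus (V := R_NormedModule)
    (fun y : R * R => sqrt (1 - snd y ^ 2) - a) fst).
  2: apply continuous_fst.
  apply (continuous_comp snd (fun z => sqrt (1 - z ^ 2) - a)).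
  - apply continuous_snd.
  - apply (continuous_minus (V := R_NormedModule) (fun z => sqrt (1 - z ^ 2)) (fun _ => a)).
    + apply (continuous_comp (fun z => 1 - z ^ 2) sqrt).
      * apply (ex_derive_continuous (fun z => 1 - z ^ 2)); auto_derive; exact I.
      * apply continuous_sqrt.
    + apply continuous_const.
Qed.

Lemma Sigma_locally (alpha beta : R) (x : R * R) :
  Sigma alpha beta x -> Rabs (snd x) < 1 -> locally x (Sigma alpha beta).
Proof.
  intros [_ [H2 H3]] H1.
  assert (L1 := locally_positive _ x (continuous_height x) ltac:(lra)).
  assert (L2 := locally_positive _ x (continuous_above_rays (cot (beta / 2)) x) ltac:(lra)).
  assert (L3 := locally_positive _ x
                  (continuous_inside_arc (sec_a alpha beta) x) ltac:(lra)).
  generalize (filter_and _ _ L1 (filter_and _ _ L2 L3)); apply filter_imp.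
  intros y [E1 [E2 E3]]; unfold Sigma; lra.
Qed.

Lemma closure_Sigma (alpha beta : R) (x : R * R) : closure (Sigma alpha beta) x ->
  Rabs (snd x) <= 1 /\ Rabs (snd x) * cot (beta / 2) <= fst x /\
  fst x <= sqrt (1 - snd x ^ 2) - sec_a alpha beta.
Proof.
  intros Hx.
  assert (H1 := closure_nonneg (Sigma alpha beta) _ x (continuous_height x)
                  ltac:(intros y [? [? ?]]; lra) Hx).
  assert (H2 := closure_nonneg (Sigma alpha beta) _ x (continuous_above_rays (cot (beta / 2)) x)
                  ltac:(intros y [? [? ?]]; lra) Hx).
  assert (H3 := closure_nonneg (Sigma alpha beta) _ x (continuous_inside_arc (sec_a alpha beta) x)
                  ltac:(intros y [? [? ?]]; lra) Hx).
  cbv beta in H1, H2, H3; lra.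
Qed.

Lemma cot_pos (x : R) : 0 < sin x -> 0 < cos x -> 0 < cot x.
Proof. intros; now apply Rdiv_lt_0_compat. Qed.

(** At the height [sin (alpha / 2)] the ray and the arc meet; above it the ray
    lies to the right of the arc, since one abscissa increases with
    the height and the other decreases. *)
Lemma below_corner (alpha beta h : R) :
  0 < beta -> beta < alpha -> alpha <= PI -> 0 <= h ->
  h * cot (beta / 2) <= sqrt (1 - h ^ 2) - sec_a alpha beta -> h <= sin (alpha / 2).
Proof.
  intros Hb Hab Ha Hh H; apply Rnot_lt_le; intros Hlt.
  destruct (sector_trig alpha beta Hb Hab Ha) as [HS [HC [HSa [HCa _]]]].
  assert (E := corner_on_ray alpha beta HS).
  assert (Hcot := cot_pos _ HS HC).
  rewrite <- (sqrt_one_minus_sin2 (alpha / 2) HCa) in E.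
  assert (sqrt (1 - h ^ 2) <= sqrt (1 - sin (alpha / 2) ^ 2)).
  { apply sqrt_le_1_alt; nra. }
  nra.
Qed.

(** A point of the closure off the ray and off the arc satisfies all the
    strict inequalities, hence is interior.  A point on the arc is on
    [Gamma_D], because [below_corner] bounds its angle by [alpha / 2]. *)
Lemma Gamma_N_on_ray (alpha beta : R) (x : R * R) :
  0 < beta -> beta < alpha -> alpha <= PI ->
  Gamma_N alpha beta x -> fst x = Rabs (snd x) * cot (beta / 2).
Proof.
  intros Hb Hab Ha [[Hcl Hcl'] HD].
  destruct (sector_trig alpha beta Hb Hab Ha) as [HS [HC [HSa [HCa _]]]].
  assert (Hpi := PI_RGT_0).
  destruct (closure_Sigma _ _ _ Hcl) as [H1 [H2 H3]].
  assert (Hpos := Rabs_pos (snd x)).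
  assert (Hc : Rabs (snd x) <= sin (alpha / 2)).
  { apply (below_corner alpha beta); try assumption.
    rewrite pow2_abs; lra. }
  (* On the arc, [x] has the polar angle [asin (snd x)] about [O]. *)
  assert (H3' : fst x < sqrt (1 - snd x ^ 2) - sec_a alpha beta).
  { apply Rnot_le_lt; intros Hge; apply HD.
    assert (Hab1 : -1 <= snd x <= 1) by (apply Rabs_le_between; exact H1).
    assert (Hsin : sin (asin (snd x)) = snd x) by (apply sin_asin; lra).
    assert (Hbd := asin_bound (snd x)).
    exists (asin (snd x)); split.
    - apply Rabs_le_between in Hc; apply Rabs_le_between; split.
      + apply Rnot_lt_le; intros Hlt.
        assert (H := sin_increasing_1 (asin (snd x)) (- (alpha / 2))
                  ltac:(lra) ltac:(lra) ltac:(lra) ltac:(lra) Hlt).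
        rewrite sin_neg in H; lra.
      + apply Rnot_lt_le; intros Hlt.
        assert (H := sin_increasing_1 (alpha / 2) (asin (snd x))
                  ltac:(lra) ltac:(lra) ltac:(lra) ltac:(lra) Hlt).
        lra.
    - destruct x as [x1 x2]; simpl in *; f_equal; [| now symmetry].
      rewrite cos_asin by lra.
      replace (1 - x2²) with (1 - x2 ^ 2) by (unfold Rsqr; ring); simpl; lra. }
  apply Rle_antisym; [apply Rnot_lt_le; intros Hlt | exact H2].
  assert (H1' : Rabs (snd x) < 1).
  { apply Rnot_le_lt; intros Hge.
    assert (Hs1 := SIN_bound (alpha / 2)).
    assert (E := corner_on_ray alpha beta HS).
    rewrite <- (sqrt_one_minus_sin2 (alpha / 2) HCa) in E.
    replace (sin (alpha / 2)) with (Rabs (snd x)) in E by lra.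
    rewrite pow2_abs in E; lra. }
  destruct (Sigma_locally alpha beta x) as [d Hd]; [unfold Sigma; lra | exact H1' |].
  destruct (Hcl' d) as [y [Hy1 Hy2]]; exact (Hy2 (Hd y Hy1)).
Qed.

(** The point at distance [exp t] from [(p1, sg * q2)] in the direction of angle
    [th - om], reflected in the horizontal axis when [sg = -1].  With
    [q2 <= 0], the sign [sg = 1] serves the lower side of the sector and
    [sg = -1] the upper one. *)
Definition polar (p1 q2 sg om t th : R) : R * R :=
  (p1 + exp t * cos (th - om), sg * (q2 + exp t * sin (th - om))).

Lemma Rabs_of_sign (sg : R) : sg * sg = 1 -> Rabs sg = 1.
Proof.
  intros Hsg.
  assert (H1 : Rabs sg * Rabs sg = 1) by (rewrite <- Rabs_mult, Hsg; apply Rabs_R1).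
  assert (H0 := Rabs_pos sg); nra.
Qed.

Lemma locally_polar (p1 q2 sg om : R) (Q : R * R -> Prop) :
  sg * sg = 1 -> locally (p1, sg * q2) Q ->
  exists T, forall t th, t < T -> Q (polar p1 q2 sg om t th).
Proof.
  intros Hsg [d Hd]; exists (ln d); intros t th Ht; apply Hd.
  assert (He : exp t < d).
  { rewrite <- (exp_ln d) by apply cond_pos; now apply exp_increasing. }
  assert (He0 := exp_pos t).
  assert (Hsg1 := Rabs_of_sign sg Hsg).
  assert (Hb : forall z, -1 <= z <= 1 -> Rabs (exp t * z) < d).
  { intros z Hz; apply Rabs_def1; nra. }
  split; simpl.
  - change (Rabs (p1 + exp t * cos (th - om) - p1) < d).
    replace (p1 + exp t * cos (th - om) - p1) with (exp t * cos (th - om)) by ring.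
    apply Hb, COS_bound.
  - change (Rabs (sg * (q2 + exp t * sin (th - om)) - sg * q2) < d).
    replace (sg * (q2 + exp t * sin (th - om)) - sg * q2)
      with (sg * (exp t * sin (th - om))) by ring.
    rewrite Rabs_mult, Hsg1, Rmult_1_l; apply Hb, SIN_bound.
Qed.

(** Near a point interior to a side, only the inequality that defines that side
    can fail, and along [polar] it reads [0 < exp t * sin th]. *)
Lemma half_disc_in_Sigma (alpha beta lambda sg : R) :
  0 < beta -> beta < alpha -> alpha <= PI -> sg * sg = 1 ->
  0 < lambda -> lambda < l_N alpha beta ->
  exists T, forall t th, t < T -> 0 < th < PI ->
    let x := polar (x1_of beta lambda) (x2_of beta lambda) sg (beta / 2) t th in
    Sigma alpha beta x /\ Rabs (snd x) < 1.
Proof.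
  intros Hb Hab Ha Hsg Hl Hl'.
  destruct (sector_trig alpha beta Hb Hab Ha) as [HS [HC [HSa [HCa _]]]].
  set (P := (x1_of beta lambda, sg * x2_of beta lambda)).
  assert (Hcot := cot_pos _ HS HC).
  assert (Hh : 0 < lambda * sin (beta / 2) < sin (alpha / 2)).
  { split; [nra |]. unfold l_N in Hl'.
    apply Rmult_lt_compat_r with (r := sin (beta / 2)) in Hl'; [| exact HS].
    unfold Rdiv in Hl'; rewrite Rmult_assoc, Rinv_l in Hl'; lra. }
  assert (Hs1 := SIN_bound (alpha / 2)).
  assert (Hsnd : - sg * snd P = lambda * sin (beta / 2)).
  { simpl; unfold x2_of; transitivity (sg * sg * (lambda * sin (beta / 2))); [ring |].
    rewrite Hsg; ring. }
  assert (Hsg1 := Rabs_of_sign sg Hsg).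
  assert (Habs : forall y, 0 < - sg * y -> Rabs y = - sg * y).
  { intros y Hy; rewrite <- (Rabs_pos_eq (- sg * y)) by lra.
    rewrite Rabs_mult, Rabs_Ropp, Hsg1; ring. }
  assert (HP : Rabs (snd P) = lambda * sin (beta / 2)).
  { rewrite Habs; lra. }
  assert (L1 := locally_positive _ P (continuous_height P) ltac:(cbv beta; rewrite HP; lra)).
  assert (L2 : locally P (fun y => 0 < - sg * snd y)).
  { apply (locally_positive (fun y => - sg * snd y)); [| lra].
    apply (continuous_mult (K := R_AbsRing) (fun _ => - sg) snd);
      [apply continuous_const | apply continuous_snd]. }
  assert (L3 := locally_positive _ P (continuous_inside_arc (sec_a alpha beta) P)).
  assert (HP3 : 0 < sqrt (1 - snd P ^ 2) - sec_a alpha beta - fst P).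
  { assert (E := corner_on_ray alpha beta HS).
    rewrite <- (sqrt_one_minus_sin2 (alpha / 2) HCa) in E.
    assert (sqrt (1 - sin (alpha / 2) ^ 2) <= sqrt (1 - snd P ^ 2)).
    { apply sqrt_le_1_alt; rewrite <- (pow2_abs (snd P)), HP; nra. }
    assert (fst P = lambda * sin (beta / 2) * cot (beta / 2)).
    { simpl; unfold x1_of, cot; field; lra. }
    nra. }
  specialize (L3 HP3).
  destruct (locally_polar (x1_of beta lambda) (x2_of beta lambda) sg (beta / 2) _ Hsg
              (filter_and _ _ L1 (filter_and _ _ L2 L3))) as [T HT].
  exists T; intros t th Ht Hth x.
  destruct (HT t th Ht) as [E1 [E2 E3]]; fold x in E1, E2, E3.
  repeat split; try lra.
  replace (Rabs (snd x)) with (- sg * snd x) by (symmetry; exact (Habs _ E2)).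
  assert (Hth' : 0 < exp t * sin th).
  { apply Rmult_lt_0_compat; [apply exp_pos | apply sin_gt_0; lra]. }
  assert (Hsum : sin th = sin (th - beta / 2) * cos (beta / 2)
                        + cos (th - beta / 2) * sin (beta / 2)).
  { rewrite <- sin_plus; f_equal; ring. }
  apply Rmult_lt_reg_r with (sin (beta / 2)); [exact HS |].
  replace (- sg * snd x * cot (beta / 2) * sin (beta / 2))
    with (- (sg * snd x) * cos (beta / 2)) by (unfold cot; field; lra).
  replace (sg * snd x) with (x2_of beta lambda + exp t * sin (th - beta / 2)).
  2: { simpl; rewrite <- Rmult_assoc, Hsg; ring. }
  simpl; unfold x1_of, x2_of; rewrite Hsum in Hth'; lra.
Qed.

(** * Regularity up to the boundary *)

Lemma continuous_of_extension (Om : R * R -> Prop) (g : R * R -> R) (x : R * R) :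
  extends_continuously Om Om g -> locally x Om -> continuous g x.
Proof.
  intros [h [Hh Hc]] Hx P HP.
  assert (Ox := locally_singleton _ _ Hx).
  rewrite <- (Hh x Ox) in HP.
  change (locally x (fun y => P (g y))).
  assert (Hc' : locally x (fun y => Om y -> P (h y))) by exact (Hc x Ox P HP).
  generalize (filter_and _ _ Hx Hc'); apply filter_imp.
  intros y [Oy Hy]; simpl; rewrite <- (Hh y Oy); exact (Hy Oy).
Qed.

Lemma extension_bounded (Om E : R * R -> Prop) (g : R * R -> R) (x : R * R) :
  extends_continuously Om E g -> E x -> (forall y, Om y -> E y) ->
  exists K, locally x (fun y => Om y -> Rabs (g y) <= K).
Proof.
  intros [h [Hh Hc]] Ex Hsub.
  exists (Rabs (h x) + 1).
  assert (HP : locally (h x) (fun z => Rabs z <= Rabs (h x) + 1)).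
  { exists (mkposreal 1 Rlt_0_1); intros z Hz.
    change (Rabs (z - h x) < 1) in Hz.
    replace z with (z - h x + h x) by ring.
    assert (H := Rabs_triang (z - h x) (h x)); lra. }
  assert (Hc' : locally x (fun y => E y -> Rabs (h y) <= Rabs (h x) + 1))
    by exact (Hc x Ex _ HP).
  revert Hc'; apply filter_imp.
  intros y Hy Oy; rewrite <- (Hh y Oy); exact (Hy (Hsub y Oy)).
Qed.

(** As [x] is in the closure of [Om], limits from within [Om] are unique, and the
    description operator in [trace] selects the limit. *)
Lemma trace_lim (Om E : R * R -> Prop) (g : R * R -> R) (x : R * R) :
  extends_continuously Om E g -> E x -> (forall y, Om y -> E y) -> closure Om x ->
  filterlim g (within Om (locally x)) (locally (trace Om g x)).
Proof.
  intros [h [Hh Hc]] Ex Hsub Hcl.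
  assert (Hl : filterlim g (within Om (locally x)) (locally (h x))).
  { intros P HP; change (locally x (fun y => Om y -> P (g y))).
    assert (Hc' : locally x (fun y => E y -> P (h y))) by exact (Hc x Ex P HP).
    revert Hc'; apply filter_imp.
    intros y Hy Oy; rewrite <- (Hh y Oy); exact (Hy (Hsub y Oy)). }
  assert (PF : ProperFilter' (within Om (locally x))).
  { constructor; [| apply within_filter; apply locally_filter].
    intros [d Hd]; destruct (Hcl d) as [y [Hy Oy]]; exact (Hd y Hy Oy). }
  replace (trace Om g x) with (h x); [exact Hl |].
  symmetry; apply (iota_unique (V := R_CompleteNormedModule)); [| exact Hl].
  intros l Hl'.
  exact (filterlim_locally_unique (V := R_NormedModule) g l (h x) Hl' Hl).
Qed.

Lemma C1_differentiable (Om : R * R -> Prop) (g : R * R -> R) (x : R * R) :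
  Cn 1 Om Om g -> locally x Om ->
  differentiable_pt_lim (fun a b => g (a, b)) (fst x) (snd x) (D1 g x) (D2 g x).
Proof.
  intros [_ [Hex [[H1 _] _]]] Hx; destruct x as [x1 x2]; simpl.
  apply filterdiff_differentiable_pt_lim.
  apply (is_derive_filterdiff (fun a b => g (a, b)) x1 x2 (fun a b => D1 g (a, b))
           (D2 g (x1, x2))).
  - revert Hx; apply filter_imp; intros [y1 y2] Oy.
    exact (Derive_correct _ _ (proj1 (Hex _ Oy))).
  - exact (Derive_correct _ _ (proj2 (Hex _ (locally_singleton _ _ Hx)))).
  - apply continuous_ext with (f := D1 g); [now intros [y1 y2] |].
    now apply continuous_of_extension with Om.
Qed.

Lemma C1_chain (Om : R * R -> Prop) (g : R * R -> R) (X Y : R -> R) (t dx dy : R) :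
  Cn 1 Om Om g -> locally (X t, Y t) Om -> is_derive X t dx -> is_derive Y t dy ->
  is_derive (fun s => g (X s, Y s)) t
    (D1 g (X t, Y t) * dx + D2 g (X t, Y t) * dy).
Proof.
  intros Hg Hx HX HY; apply is_derive_Reals.
  apply (derivable_pt_lim_comp_2d (fun a b => g (a, b)) X Y t);
    [| now apply is_derive_Reals | now apply is_derive_Reals].
  exact (C1_differentiable Om g (X t, Y t) Hg Hx).
Qed.

(** The mixed derivatives share the coefficient [dX t * dY t]; in
    [polar_laplacian] the two contributions to it cancel. *)
Lemma C2_chain (Om : R * R -> Prop) (u : R * R -> R) (X Y dX dY : R -> R)
    (t ddx ddy : R) :
  Cn 2 Om Om u ->
  locally t (fun s => locally (X s, Y s) Om /\ is_derive X s (dX s) /\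
                      is_derive Y s (dY s)) ->
  is_derive dX t ddx -> is_derive dY t ddy ->
  let x := (X t, Y t) in
  is_derive2 (fun s => u (X s, Y s)) t
    (D1 (D1 u) x * dX t ^ 2 + (D2 (D1 u) x + D1 (D2 u) x) * (dX t * dY t) +
     D2 (D2 u) x * dY t ^ 2 + D1 u x * ddx + D2 u x * ddy).
Proof.
  intros [Hu [Hex [Hu1 Hu2]]] Hloc HdX HdY x.
  exists (fun s => D1 u (X s, Y s) * dX s + D2 u (X s, Y s) * dY s); split.
  - revert Hloc; apply filter_imp; intros s [Hs [HX HY]].
    apply (C1_chain Om); try assumption.
    repeat split; try assumption; try apply Hex; try assumption.
    + exact (proj1 Hu1).
    + exact (proj1 Hu2).
  - destruct (locally_singleton _ _ Hloc) as [Hx [HX HY]].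
    assert (E1 := C1_chain Om (D1 u) X Y t _ _ Hu1 Hx HX HY).
    assert (E2 := C1_chain Om (D2 u) X Y t _ _ Hu2 Hx HX HY).
    assert (E3 := is_derive_mult _ _ t _ _ E1 HdX Rmult_comm).
    assert (E4 := is_derive_mult _ _ t _ _ E2 HdY Rmult_comm).
    assert (E := is_derive_plus _ _ t _ _ E3 E4).
    simpl in E; fold x in E.
    match type of E with is_derive _ _ ?l =>
      match goal with |- is_derive _ _ ?r => replace r with l; [exact E |] end end.
    unfold plus, mult; simpl; unfold plus, mult; simpl; ring.
Qed.

(** The map [polar] is conformal or anticonformal, with scale factor [exp t]. *)
Lemma polar_laplacian (Om : R * R -> Prop) (u : R * R -> R) (p1 q2 sg om t th : R) :
  sg * sg = 1 -> Cn 2 Om Om u ->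
  locally t (fun s => locally (polar p1 q2 sg om s th) Om) ->
  locally th (fun ph => locally (polar p1 q2 sg om t ph) Om) ->
  is_lap (fun s ph => u (polar p1 q2 sg om s ph)) t th
    (exp (2 * t) * laplacian u (polar p1 q2 sg om t th)).
Proof.
  intros Hsg Hu Ht Hth.
  set (c := cos (th - om)); set (s := sin (th - om)).
  set (x := polar p1 q2 sg om t th).
  eexists; eexists; split; [| split].
  - apply (C2_chain Om u (fun r => p1 + exp r * cos (th - om))
      (fun r => sg * (q2 + exp r * sin (th - om)))
      (fun r => exp r * cos (th - om)) (fun r => sg * (exp r * sin (th - om)))
      t (exp t * c) (sg * (exp t * s)) Hu).
    + revert Ht; apply filter_imp; intros r Hr; split; [exact Hr | split];
        auto_derive; try exact I; ring.
    + auto_derive; try exact I; unfold c; ring.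
    + auto_derive; try exact I; unfold s; ring.
  - apply (C2_chain Om u (fun ph => p1 + exp t * cos (ph - om))
      (fun ph => sg * (q2 + exp t * sin (ph - om)))
      (fun ph => - exp t * sin (ph - om)) (fun ph => sg * (exp t * cos (ph - om)))
      th (- exp t * c) (- sg * (exp t * s)) Hu).
    + revert Hth; apply filter_imp; intros r Hr; split; [exact Hr | split];
        auto_derive; try exact I; unfold Rminus; ring.
    + auto_derive; try exact I; unfold c, Rminus; ring.
    + auto_derive; try exact I; unfold s, Rminus; ring.
  - cbv beta zeta; fold c s.
    change (p1 + exp t * c, sg * (q2 + exp t * s)) with x.
    assert (Hcs : s * s + c * c = 1) by exact (sin2_cos2 (th - om)).
    replace (exp (2 * t)) with (exp t * exp t) by (rewrite <- exp_plus; f_equal; ring).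
    unfold laplacian.
    transitivity (exp t * exp t * (s * s + c * c) *
      (D1 (D1 u) x + sg * sg * D2 (D2 u) x)); [ring |].
    rewrite Hcs, Hsg; ring.
Qed.

Lemma continuity_2d_pt_polar (g : R * R -> R) (p1 q2 sg om t th : R) :
  continuous g (polar p1 q2 sg om t th) ->
  continuity_2d_pt (fun s ph => g (polar p1 q2 sg om s ph)) t th.
Proof.
  intros Hg; apply continuity_2d_pt_filterlim.
  assert (HE : forall h : R -> R, continuous h th -> forall q,
    continuous (fun z : R * R => q + exp (fst z) * h (snd z)) (t, th)).
  { intros h Hh q.
    apply (continuous_plus (V := R_NormedModule) (fun _ => q)
             (fun z : R * R => exp (fst z) * h (snd z))); [apply continuous_const |].
    apply (continuous_mult (K := R_AbsRing) (fun z : R * R => exp (fst z))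
             (fun z : R * R => h (snd z))).
    - apply (continuous_comp fst exp); [apply continuous_fst |].
      apply (ex_derive_continuous exp); auto_derive; exact I.
    - apply (continuous_comp snd h); [apply continuous_snd | exact Hh]. }
  apply (continuous_comp_2
    (fun z : R * R => p1 + exp (fst z) * cos (snd z - om))
    (fun z : R * R => sg * (q2 + exp (fst z) * sin (snd z - om)))
    (fun a b => g (a, b)) (t, th)).
  - apply (HE (fun z => cos (z - om))).
    apply (ex_derive_continuous (fun z => cos (z - om))); auto_derive; exact I.
  - apply (continuous_mult (K := R_AbsRing) (fun _ => sg)
             (fun z : R * R => q2 + exp (fst z) * sin (snd z - om)));
      [apply continuous_const |].
    apply (HE (fun z => sin (z - om))).
    apply (ex_derive_continuous (fun z => sin (z - om))); auto_derive; exact I.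
  - apply continuous_ext with (f := g); [now intros [y1 y2] | exact Hg].
Qed.

(** In the variable [r = exp t] the hypothesis bounds the derivative by [K], and
    [l] is the value at [r = 0]. *)
Lemma exponential_approach (h h' : R -> R) (T K l : R) :
  (forall s, s < T -> is_derive h s (h' s) /\ Rabs (h' s) <= K * exp s) ->
  (forall eps, 0 < eps -> exists s0, forall s, s < s0 -> Rabs (h s - l) < eps) ->
  forall t, t < T -> Rabs (h t - l) <= K * exp t.
Proof.
  intros Hh Hl t Ht; apply le_epsilon; intros eps Heps.
  destruct (Hl eps Heps) as [s0 Hs0].
  set (s := Rmin t s0 - 1).
  assert (Hs : s < t /\ s < s0).
  { assert (H1 := Rmin_l t s0); assert (H2 := Rmin_r t s0); unfold s; lra. }
  specialize (Hs0 s ltac:(lra)).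
  assert (Hexp : forall c, derivable_pt_lim (fun r => K * exp r) c (K * exp c)).
  { intros c; apply is_derive_Reals; auto_derive; [exact I | ring]. }
  assert (Hc : forall c, s <= c <= t ->
            derivable_pt_lim h c (h' c) /\ Rabs (h' c) <= K * exp c).
  { intros c Hc; destruct (Hh c ltac:(lra)) as [H1 H2]; split; [| exact H2].
    now apply is_derive_Reals. }
  destruct (MVT_cor2 (fun r => h r - K * exp r) (fun r => h' r - K * exp r) s t)
    as [c1 [E1 C1]]; [lra | |].
  { intros c H; apply (derivable_pt_lim_minus h); [now apply Hc | apply Hexp]. }
  destruct (MVT_cor2 (fun r => h r + K * exp r) (fun r => h' r + K * exp r) s t)
    as [c2 [E2 C2]]; [lra | |].
  { intros c H; apply (derivable_pt_lim_plus h); [now apply Hc | apply Hexp]. }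
  destruct (Hc c1 ltac:(lra)) as [_ B1]; destruct (Hc c2 ltac:(lra)) as [_ B2].
  apply Rabs_le_between in B1; apply Rabs_le_between in B2.
  apply Rabs_def2 in Hs0.
  assert (HK : 0 <= K * exp s).
  { destruct (Hc s ltac:(lra)) as [_ B]; assert (H := Rabs_pos (h' s)); lra. }
  apply Rabs_le; split; nra.
Qed.

(** The first derivatives of [g] are bounded near the boundary point, since they
    extend continuously to it, and are integrated along the rays from it. *)
Lemma trace_rate (Om E : R * R -> Prop) (g : R * R -> R) (p1 q2 sg om T0 : R) :
  sg * sg = 1 ->
  Cn 1 Om Om g -> Cn 1 Om E g -> (forall y, Om y -> E y) ->
  E (p1, sg * q2) -> closure Om (p1, sg * q2) ->
  (forall t th, t < T0 -> 0 < th < PI -> locally (polar p1 q2 sg om t th) Om) ->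
  exists T K, 0 <= K /\ forall t th, t < T -> 0 < th < PI ->
    Rabs (g (polar p1 q2 sg om t th) - trace Om g (p1, sg * q2)) <= K * exp t.
Proof.
  intros Hsg Hg [He [_ [[H1 _] [H2 _]]]] Hsub HP Hcl Hpol.
  destruct (extension_bounded Om E _ _ H1 HP Hsub) as [K1 HK1].
  destruct (extension_bounded Om E _ _ H2 HP Hsub) as [K2 HK2].
  destruct (locally_polar p1 q2 sg om _ Hsg (filter_and _ _ HK1 HK2)) as [T1 HT1].
  exists (Rmin T0 T1), (Rabs K1 + Rabs K2).
  split; [assert (A1 := Rabs_pos K1); assert (A2 := Rabs_pos K2); lra |].
  intros t th Ht Hth.
  apply (exponential_approach (fun s => g (polar p1 q2 sg om s th))
    (fun s => D1 g (polar p1 q2 sg om s th) * (exp s * cos (th - om)) +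
              D2 g (polar p1 q2 sg om s th) * (sg * (exp s * sin (th - om))))
    (Rmin T0 T1)); [| | exact Ht].
  - intros s Hs.
    assert (Hs0 := Rmin_l T0 T1); assert (Hs1 := Rmin_r T0 T1).
    assert (Hx := Hpol s th ltac:(lra) Hth).
    split.
    + apply (C1_chain Om g (fun r => p1 + exp r * cos (th - om))
        (fun r => sg * (q2 + exp r * sin (th - om)))); [exact Hg | exact Hx | |];
        auto_derive; try exact I; ring.
    + destruct (HT1 s th ltac:(lra)) as [B1 B2].
      assert (Ox := locally_singleton _ _ Hx).
      specialize (B1 Ox); specialize (B2 Ox).
      assert (Hsg1 := Rabs_of_sign sg Hsg).
      assert (E0 := exp_pos s).
      assert (Hb : forall z, -1 <= z <= 1 -> Rabs (exp s * z) <= exp s).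
      { intros z Hz; apply Rabs_le; nra. }
      assert (Hc := Hb _ (COS_bound (th - om))).
      assert (Hs' := Hb _ (SIN_bound (th - om))).
      eapply Rle_trans; [apply Rabs_triang |].
      rewrite Rabs_mult, (Rabs_mult (D2 g _)), (Rabs_mult sg), Hsg1, Rmult_1_l.
      assert (A1 := Rle_abs K1); assert (A2 := Rle_abs K2).
      rewrite Rmult_plus_distr_r.
      apply Rplus_le_compat; apply Rmult_le_compat; try apply Rabs_pos; lra.
  - intros eps Heps.
    assert (Hl := trace_lim Om E g _ He HP Hsub Hcl).
    assert (Hloc : locally (p1, sg * q2) (fun y => Om y ->
              Rabs (g y - trace Om g (p1, sg * q2)) < eps)).
    { exact (Hl _ (locally_ball _ (mkposreal eps Heps))). }
    destruct (locally_polar p1 q2 sg om _ Hsg Hloc) as [T2 HT2].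
    exists (Rmin T0 T2); intros s Hs.
    assert (Hs0 := Rmin_l T0 T2); assert (Hs1 := Rmin_r T0 T2).
    apply HT2; [lra |].
    exact (locally_singleton _ _ (Hpol s th ltac:(lra) Hth)).
Qed.

Lemma C2_C1 (Om E : R * R -> Prop) (g : R * R -> R) : Cn 2 Om E g -> Cn 1 Om E g.
Proof. intros [H0 [H1 [[H2 _] [H3 _]]]]; repeat split; try assumption; apply H1; assumption. Qed.

Lemma Sigma_avoids_corners (alpha beta : R) (x : R * R) :
  0 < beta -> beta < alpha -> alpha <= PI ->
  Sigma alpha beta x -> closure_minus_corners alpha beta x.
Proof.
  intros Hb Hab Ha HO.
  destruct (sector_trig alpha beta Hb Hab Ha) as [HS [HC [HSa [HCa _]]]].
  assert (E := sqrt_one_minus_sin2 (alpha / 2) HCa).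
  split; [intros eps; exists x; split; [apply ball_center | exact HO] |].
  destruct HO as [_ [H2 H3]].
  repeat split; intros ->; simpl in H2, H3.
  - rewrite Rabs_R0 in H2; lra.
  - simpl in E; lra.
  - replace (- sin (alpha / 2) * (- sin (alpha / 2) * 1))
      with (sin (alpha / 2) ^ 2) in H3 by ring.
    lra.
Qed.

(** * The sign of the tangential derivative *)

(** Both sides of the sector at once, through the sign [sg].  If [c], the
    tangential derivative at the base point, were nonnegative, the angular
    derivative [W = - c r sin th + O(r^2)] would be at most of order [r^2] from
    above, which [no_critical_boundary_point] excludes. *)
Lemma tangential_derivative_negative (alpha beta : R) (f : R -> R) (u : R * R -> R)
    (lambda sg theta_C : R) :
  0 < beta -> beta < alpha -> alpha <= PI ->
  locally_lipschitz f -> classical_solution alpha beta f u ->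
  regular_up_to_corners alpha beta u ->
  0 < lambda -> lambda < l_N alpha beta -> sg = 1 \/ sg = -1 ->
  Gamma_N alpha beta (x1_of beta lambda, sg * x2_of beta lambda) ->
  theta_C < PI -> theta_B alpha beta lambda <= theta_C -> PI / 2 < theta_C ->
  (forall vt : R,
     (0 < vt /\ vt <= theta_sup_A alpha beta lambda) \/
     (theta_B alpha beta lambda <= vt /\ vt <= theta_C) ->
     forall x : R * R,
       (fst x - x1_of beta lambda) * sin (vt - beta / 2) -
       sg * (snd x - sg * x2_of beta lambda) * cos (vt - beta / 2) = 0 ->
       Sigma alpha beta x ->
       D1 u x * sin (vt - beta / 2) - sg * D2 u x * cos (vt - beta / 2) < 0) ->
  trace (Sigma alpha beta) (D1 u) (x1_of beta lambda, sg * x2_of beta lambda)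
    * cos (beta / 2) -
  sg * trace (Sigma alpha beta) (D2 u) (x1_of beta lambda, sg * x2_of beta lambda)
    * sin (beta / 2) < 0.
Proof.
  intros Hb Hab Ha Hf Hsol Hreg Hl Hl' Hsgn HPN HCpi HBC HC2 Hmono.
  destruct (sector_trig alpha beta Hb Hab Ha) as [HS [HC [HSa [HCa _]]]].
  assert (Hpi := PI_RGT_0).
  assert (Hsg : sg * sg = 1) by (destruct Hsgn as [-> | ->]; ring).
  assert (Hsg1 := Rabs_of_sign sg Hsg).
  set (p1 := x1_of beta lambda) in *; set (q2 := x2_of beta lambda) in *.
  set (om := beta / 2) in *; set (Om := Sigma alpha beta) in *.
  set (P := (p1, sg * q2)) in *.
  assert (Hq2 : q2 < 0 /\ - q2 < sin (alpha / 2)).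
  { unfold q2, x2_of; fold om.
    unfold l_N in Hl'; fold om in Hl'.
    apply Rmult_lt_compat_r with (r := sin om) in Hl'; [| exact HS].
    unfold Rdiv in Hl'; rewrite Rmult_assoc, Rinv_l in Hl' by lra; nra. }
  assert (Hcl : closure Om P) by exact (proj1 (proj1 HPN)).
  assert (HPV : P <> ptV /\ P <> ptP_plus alpha beta /\ P <> ptP_minus alpha beta).
  { unfold P, ptV, ptP_plus, ptP_minus; repeat split; intros E; injection E;
      intros E2 _; destruct Hsgn as [-> | ->]; lra. }
  set (E := closure_minus_corners alpha beta).
  assert (HE : E P) by (split; [exact Hcl | exact HPV]).
  assert (HsubE : forall y, Om y -> E y).
  { intros y; now apply Sigma_avoids_corners. }
  assert (HuOm : Cn 2 Om Om u) by exact (sol_C2 _ _ _ _ Hsol).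
  assert (Hdir : Cn 1 Om Om (D1 u) /\ Cn 1 Om Om (D2 u)) by apply HuOm.
  assert (Hreg' : Cn 1 Om E (D1 u) /\ Cn 1 Om E (D2 u)) by apply Hreg.
  destruct (half_disc_in_Sigma alpha beta lambda sg) as [T0 HT0]; try assumption.
  fold p1 q2 om Om in HT0.
  assert (Hpol : forall t th, t < T0 -> 0 < th < PI ->
            locally (polar p1 q2 sg om t th) Om).
  { intros t th Ht Hth; destruct (HT0 t th Ht Hth); now apply Sigma_locally. }
  destruct (trace_rate Om E (D1 u) p1 q2 sg om T0) as [T1 [K1 [HK1 HT1]]];
    try assumption; try apply Hdir; try apply Hreg'.
  destruct (trace_rate Om E (D2 u) p1 q2 sg om T0) as [T2 [K2 [HK2 HT2]]];
    try assumption; try apply Hdir; try apply Hreg'.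
  fold P in HT1, HT2.
  set (l1 := trace Om (D1 u) P) in *; set (l2 := trace Om (D2 u) P) in *.
  (* The outward normal at the base point is [(- sin om, - sg * cos om)]. *)
  assert (HN : l1 * sin om + sg * l2 * cos om = 0).
  { assert (H := sol_neumann _ _ _ _ Hsol P HPN (proj1 HPV)).
    fold Om l1 l2 in H; unfold nu1, nu2 in H; fold om in H; simpl in H.
    destruct Hsgn as [-> | ->].
    - rewrite (sign_eq_m1 (1 * q2)) in H by lra; lra.
    - rewrite (sign_eq_1 (-1 * q2)) in H by lra; lra. }
  apply Rnot_le_lt; intros Hc.
  set (c := l1 * cos om - sg * l2 * sin om) in *.
  assert (Hsc : sin om * sin om + cos om * cos om = 1) by exact (sin2_cos2 om).
  assert (Hl1 : l1 = c * cos om).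
  { unfold c; transitivity (l1 * (sin om * sin om + cos om * cos om)
      - (l1 * sin om + sg * l2 * cos om) * sin om); [rewrite HN, Hsc; ring | ring]. }
  assert (Hl2 : sg * l2 = - c * sin om).
  { unfold c; transitivity (sg * l2 * (sin om * sin om + cos om * cos om)
      - (l1 * sin om + sg * l2 * cos om) * cos om); [rewrite HN, Hsc; ring | ring]. }
  destruct (Hf (u P)) as [d [L [Hd HL]]].
  assert (HuP : locally P (fun y => closure Om y -> Rabs (u y - u P) < d)).
  { exact (sol_C0 _ _ _ _ Hsol P Hcl _ (locally_ball _ (mkposreal d Hd))). }
  destruct (locally_polar p1 q2 sg om _ Hsg HuP) as [T3 HT3].
  set (T := Rmin (Rmin T0 T1) (Rmin T2 T3) - 1).
  assert (HT : T < T0 /\ T < T1 /\ T < T2 /\ T < T3).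
  { assert (A1 := Rmin_l (Rmin T0 T1) (Rmin T2 T3)).
    assert (A2 := Rmin_r (Rmin T0 T1) (Rmin T2 T3)).
    assert (A3 := Rmin_l T0 T1); assert (A4 := Rmin_r T0 T1).
    assert (A5 := Rmin_l T2 T3); assert (A6 := Rmin_r T2 T3); unfold T; lra. }
  set (x := polar p1 q2 sg om).
  set (W := fun t th => exp t * (sg * cos (th - om) * D2 u (x t th) -
                                 sin (th - om) * D1 u (x t th))).
  assert (HOm : forall t th, t <= T -> 0 < th < PI -> locally (x t th) Om).
  { intros t th Ht Hth; apply Hpol; lra. }
  assert (HW : forall t th, t <= T -> 0 < th < PI ->
    Rabs (W t th + c * exp t * sin th) <= (K1 + K2) * exp (2 * t)).
  { intros t th Ht Hth.
    specialize (HT1 t th ltac:(lra) Hth); specialize (HT2 t th ltac:(lra) Hth).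
    fold x in HT1, HT2.
    replace (2 * t) with (t + t) by ring; rewrite exp_plus.
    replace (W t th + c * exp t * sin th) with
      (exp t * (sg * (cos (th - om) * (D2 u (x t th) - l2)) +
                - sin (th - om) * (D1 u (x t th) - l1))).
    2: { replace (sin th) with (sin (th - om) * cos om + cos (th - om) * sin om)
           by (rewrite <- sin_plus; f_equal; ring).
         unfold W; rewrite Hl1.
         transitivity (exp t * (sg * cos (th - om) * D2 u (x t th)
           - sg * l2 * cos (th - om) - sin (th - om) * D1 u (x t th)
           + c * cos om * sin (th - om))); [ring | rewrite Hl2; ring]. }
    rewrite Rabs_mult, (Rabs_pos_eq (exp t)) by (left; apply exp_pos).
    replace ((K1 + K2) * (exp t * exp t)) with (exp t * (K2 * exp t + K1 * exp t))
      by ring.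
    apply Rmult_le_compat_l; [left; apply exp_pos |].
    eapply Rle_trans; [apply Rabs_triang |].
    rewrite (Rabs_mult sg), Hsg1, Rmult_1_l, !Rabs_mult, Rabs_Ropp.
    assert (B1 : Rabs (cos (th - om)) <= 1) by (apply Rabs_le, COS_bound).
    assert (B2 : Rabs (sin (th - om)) <= 1) by (apply Rabs_le, SIN_bound).
    assert (B3 := Rabs_pos (D2 u (x t th) - l2)).
    assert (B4 := Rabs_pos (D1 u (x t th) - l1)).
    apply Rplus_le_compat; nra. }
  assert (Hbig : forall t, t <= T -> exp (2 * t) <= exp T * exp t).
  { intros t Ht; rewrite <- exp_plus.
    destruct (Req_dec t T) as [-> | Hne]; [right; f_equal; ring |].
    left; apply exp_increasing; lra. }
  assert (HU : angular_solution f (Rabs L) (c + (K1 + K2) * exp T) T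
                 (fun t th => u (x t th)) W).
  { assert (Hcont : forall g, extends_continuously Om Om g -> forall t th,
      t <= T -> 0 < th < PI -> continuity_2d_pt (fun s ph => g (x s ph)) t th).
    { intros g Hg t th Ht Hth; apply continuity_2d_pt_polar.
      apply continuous_of_extension with Om; [exact Hg | now apply HOm]. }
    constructor.
    - intros t th Ht Hth.
      replace (- exp (2 * t) * f (u (x t th)))
        with (exp (2 * t) * laplacian u (x t th)).
      2: { assert (H := sol_eq _ _ _ _ Hsol (x t th)
                          (locally_singleton _ _ (HOm t th Ht Hth))).
           replace (laplacian u (x t th)) with (- f (u (x t th))) by lra; ring. }
      apply polar_laplacian with Om; try assumption.
      + apply filter_imp with (fun s => s < T0).
        * intros s Hs; now apply Hpol.
        * apply open_lt; lra.
      + apply filter_imp with (fun s => 0 < s /\ s < PI).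
        * intros s Hs; now apply HOm.
        * apply filter_and; [apply open_gt | apply open_lt]; lra.
    - apply Hcont; apply HuOm.
    - intros t th Ht Hth.
      assert (D := C1_chain Om u (fun ph => p1 + exp t * cos (ph - om))
        (fun ph => sg * (q2 + exp t * sin (ph - om))) th
        (- exp t * sin (th - om)) (sg * (exp t * cos (th - om)))
        (C2_C1 _ _ _ HuOm) (HOm t th Ht Hth)).
      replace (W t th) with (D1 u (x t th) * (- exp t * sin (th - om)) +
        D2 u (x t th) * (sg * (exp t * cos (th - om)))) by (unfold W; ring).
      apply D; auto_derive; try exact I; unfold Rminus; ring.
    - intros t th Ht Hth.
      apply continuity_2d_pt_ext with (fun s ph =>
        sg * wedge 1 1 (om - PI / 2) s ph * D2 u (x s ph) -
        wedge 1 1 om s ph * D1 u (x s ph)).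
      { intros s ph; unfold W, wedge.
        rewrite !Rmult_1_l; replace (ph - (om - PI / 2)) with (PI / 2 + (ph - om)) by ring.
        rewrite <- cos_sin; ring. }
      apply continuity_2d_pt_minus; apply continuity_2d_pt_mult;
        try (apply Hcont; try assumption; apply Hdir).
      + apply continuity_2d_pt_scal_wedge.
      + apply continuity_2d_pt_wedge.
    - apply Rabs_pos.
    - intros t th ph Ht Hth Hph.
      assert (Hnear : forall ps, 0 < ps < PI -> Rabs (u (x t ps) - u P) < d).
      { intros ps Hps; apply HT3; [lra |].
        exact (proj1 (HsubE _ (locally_singleton _ _ (HOm t ps Ht Hps)))). }
      eapply Rle_trans; [apply HL; now apply Hnear |].
      apply Rmult_le_compat_r; [apply Rabs_pos | apply Rle_abs].
    - intros t th Ht Hth; specialize (HW t th Ht Hth); specialize (Hbig t Ht).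
      assert (B1 := SIN_bound th); assert (B2 := exp_pos t).
      assert (B3 : 0 < sin th) by (apply sin_gt_0; lra).
      assert (B4 : 0 <= c * exp t * sin th <= c * exp t).
      { assert (0 <= c * exp t) by (apply Rmult_le_pos; lra). split; nra. }
      assert (B5 : (K1 + K2) * exp (2 * t) <= (K1 + K2) * (exp T * exp t))
        by (apply Rmult_le_compat_l; lra).
      apply Rabs_le_between in HW; apply Rabs_le; lra. }
  apply (no_critical_boundary_point f _ _ (K1 + K2) T _ W (theta_sup_A alpha beta lambda)
           (theta_B alpha beta lambda) theta_C HU); try assumption.
  - intros t th Ht Hth; specialize (HW t th Ht Hth).
    assert (B3 : 0 < sin th) by (apply sin_gt_0; lra).
    assert (B4 : 0 <= c * exp t * sin th).
    { apply Rmult_le_pos; [apply Rmult_le_pos |]; try lra; left; apply exp_pos. }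
    apply Rabs_le_between in HW; lra.
  - unfold theta_sup_A, theta_A, theta_B, arccot.
    repeat apply Rmin_pos; try lra;
      match goal with |- context [atan ?y] => assert (H := atan_bound y) end; lra.
  - assert (H1 := theta_B_lt_2_theta_A alpha beta lambda Hb Hab Ha Hl).
    assert (H2 : 0 < theta_B alpha beta lambda).
    { unfold theta_B, arccot.
      match goal with |- context [atan ?y] => assert (H := atan_bound y) end; lra. }
    unfold theta_sup_A.
    apply Rmult_lt_reg_l with (/ 2); [lra |].
    replace (/ 2 * (2 * Rmin (theta_A alpha beta lambda)
      (Rmin (theta_B alpha beta lambda) ((PI + beta) / 2)))) with
      (Rmin (theta_A alpha beta lambda)
        (Rmin (theta_B alpha beta lambda) ((PI + beta) / 2))) by field.
    repeat apply Rmin_glb_lt; lra.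
  - intros t th Ht Hth Hset.
    assert (Ox := locally_singleton _ _ (HOm t th Ht Hth)).
    assert (Hneg : D1 u (x t th) * sin (th - om) - sg * D2 u (x t th) * cos (th - om) < 0).
    { apply Hmono; [destruct Hset; [left | right]; lra | | exact Ox].
      simpl; transitivity (exp t * cos (th - om) * sin (th - om) * (1 - sg * sg));
        [ring | rewrite Hsg; ring]. }
    unfold W; apply Rmult_lt_0_compat; [apply exp_pos | lra].
Qed.

(** The line with [vt = PI / 2] is perpendicular to the side. *)
Lemma perpendicular_foot (alpha beta lambda sg : R) (x : R * R) :
  0 < beta -> beta < alpha -> alpha <= PI -> sg = 1 \/ sg = -1 ->
  Gamma_N alpha beta x -> sg * snd x < 0 ->
  (fst x - x1_of beta lambda) * sin (PI / 2 - beta / 2) -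
  sg * (snd x - sg * x2_of beta lambda) * cos (PI / 2 - beta / 2) = 0 ->
  x = (x1_of beta lambda, sg * x2_of beta lambda).
Proof.
  intros Hb Hab Ha Hsgn HN Hneg Hline.
  destruct (sector_trig alpha beta Hb Hab Ha) as [HS [HC _]].
  assert (Hray := Gamma_N_on_ray alpha beta x Hb Hab Ha HN).
  rewrite sin_shift, cos_shift in Hline.
  assert (Hsc := sin2_cos2 (beta / 2)); unfold Rsqr in Hsc.
  assert (Hsg : sg * sg = 1) by (destruct Hsgn as [-> | ->]; ring).
  assert (Habs : Rabs (snd x) = - (sg * snd x)).
  { rewrite <- (Rabs_left (sg * snd x)) by exact Hneg.
    rewrite Rabs_mult, (Rabs_of_sign sg Hsg); ring. }
  destruct x as [x1 x2]; simpl in *; rewrite Habs in Hray.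
  set (S := sin (beta / 2)) in *; set (C := cos (beta / 2)) in *.
  assert (Hx1 : x1 * S = - (sg * x2) * C).
  { rewrite Hray; unfold cot; fold S C; field; lra. }
  assert (Hd : sg * x2 = - lambda * S).
  { unfold x1_of, x2_of in Hline; fold S C in Hline.
    assert (E : (x1 * S) * C - lambda * S * C * C - sg * x2 * S * S
                - sg * sg * lambda * S * S * S = 0).
    { transitivity (S * ((x1 - lambda * C) * C
        - sg * (x2 - sg * (- lambda * S)) * S)); [ring | rewrite Hline; ring]. }
    rewrite Hx1, Hsg in E.
    assert (E' : (sg * x2 + lambda * S) * (S * S + C * C) = 0) by lra.
    rewrite Hsc in E'; lra. }
  unfold x1_of, x2_of; fold S C; f_equal.
  - apply Rmult_eq_reg_r with S; [| lra]; rewrite Hx1, Hd; ring.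
  - rewrite <- Hd, <- Rmult_assoc, Hsg; ring.
Qed.

Theorem lemma3p7 (alpha beta : R) (f : R -> R) (u : R * R -> R) (Lambda : R) :
  0 < beta -> beta < alpha -> alpha <= PI ->
  locally_lipschitz f ->
  classical_solution alpha beta f u ->
  regular_up_to_corners alpha beta u ->
  0 < Lambda -> Lambda < l_N alpha beta ->
  (exists theta_C : R,
     0 < theta_C /\ theta_C < PI /\
     theta_B alpha beta Lambda <= theta_C /\ PI / 2 < theta_C /\
     forall vt : R,
       (0 < vt /\ vt <= theta_sup_A alpha beta Lambda) \/
       (theta_B alpha beta Lambda <= vt /\ vt <= theta_C) ->
       (forall x : R * R, lineT beta Lambda vt x -> Sigma alpha beta x ->
          D1 u x * sin (vt - beta / 2) - D2 u x * cos (vt - beta / 2) < 0) /\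
       (forall x : R * R, lineT_hat beta Lambda vt x -> Sigma alpha beta x ->
          D1 u x * sin (vt - beta / 2) + D2 u x * cos (vt - beta / 2) < 0)) ->
  (forall x : R * R,
     lineT beta Lambda (PI / 2) x -> Gamma_N_minus alpha beta x ->
     trace (Sigma alpha beta) (D1 u) x * cos (beta / 2) -
     trace (Sigma alpha beta) (D2 u) x * sin (beta / 2) < 0) /\
  (forall x : R * R,
     lineT_hat beta Lambda (PI / 2) x -> Gamma_N_plus alpha beta x ->
     trace (Sigma alpha beta) (D1 u) x * cos (beta / 2) +
     trace (Sigma alpha beta) (D2 u) x * sin (beta / 2) < 0).
Proof.
  intros Hb Hab Ha Hf Hsol Hreg Hl Hl' [theta_C [_ [HCpi [HBC [HC2 Hmono]]]]].
  split.
  - intros x Hline [HN Hneg].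
    assert (Hx := perpendicular_foot alpha beta Lambda 1 x Hb Hab Ha
                    (or_introl eq_refl) HN).
    assert (Ex : x = (x1_of beta Lambda, 1 * x2_of beta Lambda)).
    { apply Hx; [lra |]; unfold lineT in Hline; lra. }
    rewrite Ex in HN |- *.
    enough (H : trace (Sigma alpha beta) (D1 u) (x1_of beta Lambda, 1 * x2_of beta Lambda)
        * cos (beta / 2) - 1 *
      trace (Sigma alpha beta) (D2 u) (x1_of beta Lambda, 1 * x2_of beta Lambda)
        * sin (beta / 2) < 0) by lra.
    apply (tangential_derivative_negative alpha beta f u Lambda 1 theta_C); auto.
    intros vt Hvt y Hy HO.
    assert (H := proj1 (Hmono vt Hvt) y ltac:(unfold lineT; lra) HO); lra.
  - intros x Hline [HN Hneg].
    assert (Hx := perpendicular_foot alpha beta Lambda (-1) x Hb Hab Ha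
                    (or_intror eq_refl) HN).
    assert (Ex : x = (x1_of beta Lambda, -1 * x2_of beta Lambda)).
    { apply Hx; [lra |]; unfold lineT_hat in Hline; lra. }
    rewrite Ex in HN |- *.
    enough (H : trace (Sigma alpha beta) (D1 u) (x1_of beta Lambda, -1 * x2_of beta Lambda)
        * cos (beta / 2) - -1 *
      trace (Sigma alpha beta) (D2 u) (x1_of beta Lambda, -1 * x2_of beta Lambda)
        * sin (beta / 2) < 0) by lra.
    apply (tangential_derivative_negative alpha beta f u Lambda (-1) theta_C); auto.
    intros vt Hvt y Hy HO.
    assert (H := proj2 (Hmono vt Hvt) y ltac:(unfold lineT_hat; lra) HO); lra.
Qed.
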